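(* Let $X, Y$ be Banach spaces with $X$ reflexive, $\Omega\subseteq X$ an open set, $F:\Omega\to Y$ a continuously Fréchet differentiable function, $C\subset Y$ a nonempty closed convex cone, $R>0$ and $f:[0,R)\to\mathbb{R}$ a continuously differentiable function. Suppose that $\tilde{x}\in\Omega$, that $F$ satisfies Robinson's condition at $\tilde{x}$ (i.e. $\mathrm{rge}\,T_{\tilde{x}}=Y$), that $f$ is a majorant function for $F$ at $\tilde{x}$ which also satisfies (h4): $f(t)<0$ for some $t\in(0,R)$, and that $$\|T_{\tilde{x}}^{-1}(-F(\tilde{x}))\|\le f(0).$$ Define $\beta:=\sup\{-f(t): t\in[0,R)\}$. Let $0\le\rho<\beta/2$ and $g:[0,R-\rho)\to\mathbb{R}$, $$g(t):=\frac{-1}{f'(\rho)}[f(t+\rho)+2\rho].$$ Then $g$ has a smallest zero $t_{*,\rho}\in(0,R-\rho)$, and the sequences generated by Newton's method for solving the inclusion $F(x)\in C$ and the equation $g(t)=0$, with starting points $x_0=\hat{x}$, for any $\hat{x}\in B(\tilde{x},\rho)$, and $t_0=0$ respectively, $$x_{k+1}\in x_k+\mathrm{argmin}\{\|d\| : F(x_k)+F'(x_k)d\in C\},\qquad t_{k+1}=t_k-\frac{g(t_k)}{g'(t_k)},\qquad k=0,1,\ldots,$$ are well defined; $\{x_k\}$ is contained in $B(\tilde{x},t_{*,\rho})$; $\{t_k\}$ is strictly increasing, is contained in $[0,t_{*,\rho})$ and converges to $t_{*,\rho}$; and $$\|x_{k+1}-x_k\|\le t_{k+1}-t_k,\qquad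 k=0,1,\ldots,$$ $$\|x_{k+1}-x_k\|\le\frac{t_{k+1}-t_k}{(t_k-t_{k-1})^2}\|x_k-x_{k-1}\|^2\le\frac{D^-g'(t_{*,\rho})}{-2g'(t_{*,\rho})}\|x_k-x_{k-1}\|^2,\qquad k=1,2,\ldots.$$ Moreover, $\{x_k\}$ converges to some $x_*\in B[\tilde{x},t_{*,\rho}]$ such that $F(x_* )\in C$, $$\|x_*-x_k\|\le t_{*,\rho}-t_k,\qquad t_{*,\rho}-t_{k+1}\le\tfrac12(t_{*,\rho}-t_k),\qquad k=0,1,\ldots,$$ and the convergence of $\{x_k\}$ and $\{t_k\}$ to $x_*$ and $t_{*,\rho}$, respectively, is $Q$-quadratic as follows: $$\limsup_{k\to\infty}\frac{\|x_*-x_{k+1}\|}{\|x_*-x_k\|^2}\le\frac{D^-g'(t_{*,\rho})}{-2g'(t_{*,\rho})},\qquad t_{*,\rho}-t_{k+1}\le\frac{D^-g'(t_{*,\rho})}{-2g'(t_{*,\rho})}(t_{*,\rho}-t_k)^2,\quad k=0,1,\ldots.$$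
   Context: $B(x,\delta)$ and $B[x,\delta]$ are the open and closed balls with centre $x$ and radius $\delta$. For $z\in\Omega$, $T_z:X\rightrightarrows Y$ is the set-valued map $T_zd=F'(z)d-C$, and $T_z^{-1}:Y\rightrightarrows X$ is its inverse, $T_z^{-1}y=\{d\in X: F'(z)d-y\in C\}$. $\mathrm{rge}\,T_z=\bigcup_{d\in X}T_zd$. For a set-valued map $S$ between Banach spaces, $\mathrm{dom}\,S=\{d: Sd\ne\varnothing\}$, $\|Sd\|:=\inf\{\|v\|: v\in Sd\}$ (with $\|Sd\|=+\infty$ if $Sd=\varnothing$), and $\|S\|:=\sup\{\|Sd\|: d\in\mathrm{dom}\,S,\ \|d\|\le1\}$. For a linear map $A:X\to Y$, $T_z^{-1}A$ is the composition $d\mapsto T_z^{-1}(Ad)$. A continuously differentiable $f:[0,R)\to\mathbb{R}$ is a majorant function for $F$ at $\tilde{x}\in\Omega$ if $B(\tilde{x},R)\subseteq\Omega$, $$\|T_{\tilde{x}}^{-1}[F'(y)-F'(x)]\|\le f'(\|y-x\|+\|x-\tilde{x}\|)-f'(\|x-\tilde{x}\|)$$ for all $x,y\in B(\tilde{x},R)$ with $\|x-\tilde{x}\|+\|y-x\|<R$, and: (h1) $f(0)>0$, $f'(0)=-1$; (h2) $f'$ is convex and strictly increasing; (h3) $f(t)=0$ for some $t\in(0,R)$. $D^-\varphi(s_0)=\lim_{s\to s_0^-}\frac{\varphi(s_0)-\varphi(s)}{s_0-s}$ is the left derivative of a convex function. The sequence $\{x_k\}$ is any sequence obtained by choosing at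 each step an element of the (possibly multi-element) argmin set.
   Formalization: The balls containing $\{x_k\}$ and $x_*$ are centred at the starting point $\hat{x}$ instead of $\tilde{x}$: $x_k\in B(\hat{x},t_{*,\rho})$, $x_*\in B[\hat{x},t_{*,\rho}]$; the claim with centre $\tilde{x}$ fails, e.g. in $\mathbb{R}^2$ with the max norm. *)

(* Defs.v *)
From mathcomp Require Export all_boot all_order all_algebra.
From mathcomp Require Export all_classical all_reals all_analysis.
Export Order.TTheory GRing.Theory Num.Theory.
Export numFieldNormedType.Exports.

Set Implicit Arguments.
Unset Strict Implicit.
Unset Printing Implicit Defensive.

#[export] Set Implicit Arguments.
#[export] Unset Strict Implicit.
#[export] Unset Printing Implicit Defensive.

Local Open Scope classical_set_scope.
Local Open Scope ring_scope.

Section RealFunctions.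
Context {K : realType}.
Implicit Types (A : set K) (f : K -> K) (t : K).

(* The derivative of f : A -> K; at 0, for A = [0, R), it is the right
   derivative. A function on A is encoded by a total f whose values outside A
   are irrelevant. *)
Definition derive_on A f t : K :=
  lim ((f s - f t) / (s - t) @[s --> within A t^']).

Definition derivable_on A f t : Prop :=
  cvg ((f s - f t) / (s - t) @[s --> within A t^']).

Definition C1_on A f : Prop :=
  (forall t, A t -> derivable_on A f t) /\ {within A, continuous (derive_on A f)}.

(* D^- f (t) *)
Definition left_derive f t : K :=
  lim ((f t - f s) / (t - s) @[s --> t^'-]).

Definition newton_iter A f (k : nat) : K :=
  iter k (fun s => s - f s / derive_on A f s) 0.

Definition smallest_zero A f t : Prop :=
  [/\ A t, f t = 0 & forall s, A s -> f s = 0 -> t <= s].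

End RealFunctions.

Section Reflexivity.
Context {K : realType} (X : normedModType K).

Definition dual (phi : X -> K^o) : Prop := linear phi /\ continuous phi.

Definition dual_norm (phi : X -> K^o) : K :=
  sup [set `|phi x| | x in [set x | `|x| <= 1]].

(* The canonical map of X into its bidual is onto. A functional Phi on the dual
   is encoded by a map whose values outside the dual are irrelevant. *)
Definition reflexive_space : Prop :=
  forall Phi : (X -> K^o) -> K,
    (forall a phi psi, dual phi -> dual psi ->
       Phi (fun x => a *: phi x + psi x) = a * Phi phi + Phi psi) ->
    (exists M, forall phi, dual phi -> `|Phi phi| <= M * dual_norm phi) ->
    exists x, forall phi, dual phi -> Phi phi = phi x.

End Reflexivity.

Section SetValued.
Context {K : realType} {X Y : normedModType K}.

Definition svdom (S : X -> set Y) : set X := [set d | S d !=set0].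

Definition svrge (S : X -> set Y) : set Y := \bigcup_d S d.

Definition svinv (S : X -> set Y) : Y -> set X := fun y => [set d | S d y].

(* +oo on the empty set *)
Definition set_norm (A : set X) : \bar K := ereal_inf [set `|v|%:E | v in A].

End SetValued.

Definition svnorm {K : realType} {X Y : normedModType K} (S : X -> set Y) :
    \bar K :=
  ereal_sup [set set_norm (S d) | d in svdom S `&` [set d | `|d| <= 1]].

Section ConeInclusion.
Context {K : realType} {X Y : normedModType K}.
Implicit Types (Omega : set X) (F : X -> Y) (C : set Y) (z : X).

(* The second clause is the continuity of x |-> F'(x) in operator norm. *)
Definition C1_frechet Omega F : Prop :=
  (forall x, Omega x -> differentiable F x) /\
  (forall x, Omega x -> forall e : K, 0 < e ->
     \forall y \near x, forall d, `|'d F y d - 'd F x d| <= e * `|d|).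

Definition closed_convex_cone C : Prop :=
  [/\ C !=set0, closed C, convex_set C &
      forall (a : K) y, 0 < a -> C y -> C (a *: y)].

Definition T_ F C z : X -> set Y := fun d => [set 'd F z d - c | c in C].

Definition Tinv F C z : Y -> set X := svinv (T_ F C z).

Lemma TinvE F C z y : Tinv F C z y = [set d | C ('d F z d - y)].
Proof.
apply/seteqP; split => d /=.
  by move=> [c Cc <-]; rewrite opprB addrC subrK.
by move=> Cd; exists ('d F z d - y) => //; rewrite subKr.
Qed.

Definition robinson F C z : Prop := svrge (T_ F C z) = setT.

Definition majorant Omega F C (xt : X) (R : K) (f : K -> K) : Prop :=
  let df := derive_on `[0, R[ f in
  [/\ C1_on `[0, R[ f,
      ball xt R `<=` Omega,
      forall x y, ball xt R x -> ball xt R y -> `|x - xt| + `|y - x| < R ->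
        (svnorm (fun d => Tinv F C xt ('d F y d - 'd F x d)%R) <=
          (df (`|y - x| + `|x - xt|) - df `|x - xt|)%:E)%E &
      [/\ 0 < f 0 /\ df 0 = -1,
          convex_function (`[0, R[%classic : set K) df,
          {in `[0, R[ &, {homo df : s t / s < t}} &
          exists2 t, t \in `]0, R[ & f t = 0]].

Definition feasible F C x : set X := [set d | C (F x + 'd F x d)].

Definition newton_dirs F C x : set X :=
  [set d | feasible F C x d /\ forall d', feasible F C x d' -> `|d| <= `|d'|].

Definition newton_step F C x x' : Prop :=
  [set x + d | d in newton_dirs F C x] x'.

End ConeInclusion.

(* Main.v *)
From HB Require Import structures.
Require Import Defs.
From mathcomp Require Import ring lra.

(* In a reflexive space the infima in the norms of the inclusions
   A d - y \in C are attained, and the set of pairs (y, r) for which A d - y \in C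
   has a solution with |d| <= r is a closed convex cone D.  The error
   F y - F x - F'(x) (y - x), paired with the corresponding error of the majorant
   f, is the increment of a curve whose derivative lies in D by the majorant
   condition; by Hahn-Banach and the scalar mean value theorem the increment lies
   in D as well.  A Neumann series transports solvability from the centre to
   nearby points.  Hence the step of Newton's method for F is dominated by the
   scalar step, by induction.  For a starting point xh at distance less than rho
   from xt, g majorizes F at xh, which reduces the theorem to a method started at
   the centre of the majorant condition. *)

Local Open Scope classical_set_scope.
Local Open Scope ring_scope.

(** * Hahn-Banach separation for convex cones *)

Section HahnBanach.
Context {K : realType}.

Lemma lin0 (V W : lmodType K) (l : V -> W) : linear l -> l 0 = 0.
Proof. by move=> ll; have := ll (-1) 0 0; rewrite scaler0 addr0 scaleN1r addNr. Qed.

Lemma linZ (V W : lmodType K) (l : V -> W) a x : linear l -> l (a *: x) = a *: l x.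
Proof. by move=> ll; have := ll a x 0; rewrite (lin0 ll) !addr0. Qed.

Lemma linD (V W : lmodType K) (l : V -> W) x y : linear l -> l (x + y) = l x + l y.
Proof. by move=> ll; have := ll 1 x y; rewrite !scale1r. Qed.

Definition sublinear (V : lmodType K) (q : V -> K) : Prop :=
  (forall x y, q (x + y) <= q x + q y) /\
  (forall a x, 0 < a -> q (a *: x) <= a * q x).

Lemma sublinearZ (V : lmodType K) (q : V -> K) a x :
  sublinear q -> 0 <= a -> q (a *: x) = a * q x.
Proof.
move=> [_ qZ]; rewrite le_eqVlt => /predU1P[<-|a0].
  rewrite scale0r mul0r; apply/eqP; rewrite eq_le; apply/andP; split.
    by have := qZ (1/2) 0 ltac:(lra); rewrite scaler0; lra.
  by have := qZ 2 0 ltac:(lra); rewrite scaler0; lra.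
apply/eqP; rewrite eq_le qZ//=.
have := qZ a^-1 (a *: x); rewrite invr_gt0 => /(_ a0).
by rewrite scalerA mulVf ?gt_eqF// scale1r ler_pdivlMl.
Qed.

Lemma sublinear_ge (V : lmodType K) (q : V -> K) x :
  sublinear q -> - q (- x) <= q x.
Proof.
move=> sq; have := sq.1 x (- x).
by have := @sublinearZ _ _ 0 0 sq (lexx 0); rewrite subrr scale0r mul0r => ->; lra.
Qed.

Lemma inf_le (A : set K) m x : (forall y, A y -> m <= y) -> A x -> inf A <= x.
Proof. by move=> Am Ax; apply: ge_inf => //; exists m => y /Am. Qed.

(* A sublinear functional below q, with tilt q y x <= q (x + y) - q y; if q is
   minimal then q = tilt q y, so q is superadditive too. *)
Definition tilt (V : lmodType K) (q : V -> K) (y x : V) : K :=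
  inf [set q (x + t *: y) - t * q y | t in [set t | 0 <= t]].

Lemma tilt_le (V : lmodType K) (q : V -> K) y x t : sublinear q -> 0 <= t ->
  tilt q y x <= q (x + t *: y) - t * q y.
Proof.
move=> sq t0; apply: (@inf_le _ (- q (- x))); last by exists t.
move=> _ [s /= s0 <-]; have := sq.1 (x + s *: y) (- x).
by rewrite addrAC subrr add0r (sublinearZ _ sq)//; lra.
Qed.

Lemma tilt_ge (V : lmodType K) (q : V -> K) y x m :
  (forall t, 0 <= t -> m <= q (x + t *: y) - t * q y) -> m <= tilt q y x.
Proof.
move=> mq; apply: lb_le_inf; first by exists (q (x + 0 *: y) - 0 * q y), 0 => /=.
by move=> _ [t /= t0 <-]; exact: mq.
Qed.

Lemma tilt_sublinear (V : lmodType K) (q : V -> K) y :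
  sublinear q -> sublinear (tilt q y).
Proof.
move=> sq.
split=> [u v|a u a0].
  rewrite -lerBlDr; apply: tilt_ge => t t0.
  rewrite lerBlDr -lerBlDl; apply: tilt_ge => s s0.
  rewrite lerBlDr.
  have := tilt_le y (u + v) sq (addr_ge0 s0 t0).
  have := sq.1 (v + s *: y) (u + t *: y).
  rewrite scalerDl (_ : v + s *: y + (u + t *: y) = u + v + (s *: y + t *: y)).
    by rewrite mulrDl; lra.
  by rewrite addrACA (addrC v).
rewrite -ler_pdivrMl//; apply: tilt_ge => t t0.
rewrite ler_pdivrMl//; apply: le_trans (@tilt_le _ _ _ _ (a * t) sq _) _.
  by rewrite mulr_ge0// ltW.
by rewrite -scalerA -scalerDr sublinearZ ?(ltW a0)// mulrBr mulrA.
Qed.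

Lemma tilt_le0 (V : lmodType K) (q : V -> K) y x : sublinear q -> tilt q y x <= q x.
Proof.
by move=> sq; have := tilt_le y x sq (lexx 0); rewrite scale0r addr0 mul0r subr0.
Qed.

Lemma minimal_sublinear_additive (V : lmodType K) (q : V -> K) :
  sublinear q ->
  (forall q', sublinear q' -> (forall x, q' x <= q x) -> forall x, q x <= q' x) ->
  forall x y, q (x + y) = q x + q y.
Proof.
move=> sq qmin x y; apply/eqP; rewrite eq_le sq.1/=.
have := qmin _ (tilt_sublinear y sq) (fun z => tilt_le0 y z sq) x.
by have := tilt_le y x sq ler01; rewrite scale1r mul1r; lra.
Qed.

Lemma hahn_banach (V : lmodType K) (p : V -> K) : sublinear p ->
  exists l : V -> K^o, linear l /\ forall x, l x <= p x.
Proof.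
move=> sp.
pose T := {q : V -> K | sublinear q /\ forall x, q x <= p x}.
pose Rel (s t : T) := `[< forall x, sval t x <= sval s x >].
have [||A Atot|[q [sq qp]] qmax] := @ZL_preorder T (exist _ p (conj sp (fun x => lexx _))) Rel.
- by move=> t; apply/asboolP.
- move=> r s t /asboolP rs /asboolP st; apply/asboolP => x.
  exact: le_trans (st x) (rs x).
- have [[t0 At0]|A0] := pselect (A !=set0); last first.
    exists (exist _ p (conj sp (fun x => lexx _))) => s As.
    by exfalso; apply: A0; exists s.
  pose B x := [set sval t x | t in A].
  have lbB x r : B x r -> - p (- x) <= r.
    move=> [[t [st tp]] _ <-] /=; apply: le_trans (sublinear_ge x st).
    by rewrite lerN2.
  have B0 x : B x !=set0 by exists (sval t0 x), t0.
  have infle x (t : T) : A t -> inf (B x) <= sval t x.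
    by move=> At; apply: (inf_le (@lbB x)); exists t.
  have sB : sublinear (fun x => inf (B x)).
    split=> [x y|a x a0].
      rewrite -lerBlDr; apply: lb_le_inf => // _ [s As <-].
      rewrite lerBlDr -lerBlDl; apply: lb_le_inf => // _ [t At <-].
      rewrite lerBlDr.
      have [/asboolP/= st|/asboolP/= ts] := Atot _ _ As At.
        have := infle (x + y) t At; have := (svalP t).1.1 x y.
        by have := st x; lra.
      have := infle (x + y) s As; have := (svalP s).1.1 x y.
      by have := ts y; lra.
    rewrite -ler_pdivrMl//; apply: lb_le_inf => // _ [t At <-].
    rewrite ler_pdivrMl//; apply: le_trans (infle _ t At) _.
    exact: (svalP t).1.2.
  have Bp x : inf (B x) <= p x.
    exact: le_trans (infle x t0 At0) ((svalP t0).2 x).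
  pose PT q := sublinear q /\ forall x, q x <= p x.
  exists (exist PT (fun x => inf (B x)) (conj sB Bp)) => s As; apply/asboolP => x /=.
  exact: infle.
have qmin q' : sublinear q' -> (forall x, q' x <= q x) -> forall x, q x <= q' x.
  move=> sq' q'q.
  have q'p x : q' x <= p x by exact: le_trans (q'q x) (qp x).
  pose PT q0 := sublinear q0 /\ forall x, q0 x <= p x.
  by have /asboolP := qmax (exist PT q' (conj sq' q'p)) (asboolT q'q).
have qD := minimal_sublinear_additive sq qmin.
have q0 : q 0 = 0 by have := @sublinearZ _ _ 0 0 sq (lexx 0); rewrite scale0r mul0r.
have qN x : q (- x) = - q x.
  by apply/eqP; rewrite -addr_eq0 -qD addNr q0.
exists q; split=> // a x y; rewrite qD; congr (_ + _).
have [a0|a0] := leP 0 a; first exact: sublinearZ.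
have : q (- a *: x) = - a * q x by rewrite sublinearZ// oppr_ge0 ltW.
by rewrite scaleNr qN mulNr => /oppr_inj.
Qed.

Lemma hahn_banach_at (V : lmodType K) (p : V -> K) z : sublinear p ->
  exists l : V -> K^o, [/\ linear l, forall x, l x <= p x & l z = p z].
Proof.
move=> sp; have [l [ll lp]] := hahn_banach (tilt_sublinear z sp).
have lp' x : l x <= p x by apply: le_trans (lp x) (tilt_le0 _ _ sp).
exists l; split=> //; apply/eqP; rewrite eq_le lp'/=.
have := le_trans (lp (- z)) (tilt_le z (- z) sp ler01).
rewrite -scaleN1r (linZ _ _ ll) scaleN1r.
rewrite scale1r scaleN1r addNr mul1r.
have := @sublinearZ _ _ 0 0 sp (lexx 0); rewrite scale0r mul0r => ->; lra.
Qed.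

Definition cone (V : lmodType K) (C : set V) : Prop :=
  [/\ C 0, forall x y, C x -> C y -> C (x + y) &
      forall a x, 0 < a -> C x -> C (a *: x)].

(* Hahn-Banach for the distance to C. *)
Lemma cone_separation (V : normedModType K) (C : set V) z :
  cone C -> closed C -> ~ C z ->
  exists l : V -> K^o, [/\ linear l, forall x, `|l x| <= `|x|,
    forall x, C x -> l x <= 0 & 0 < l z].
Proof.
move=> [C0 CD CZ] Ccl Cz.
pose B x := [set `|x - c| | c in C].
pose p x : K := inf (B x).
have B0 x : B x !=set0 by exists `|x - 0|, 0.
have ple x c : C c -> p x <= `|x - c|.
  by move=> Cc; apply: (@inf_le _ 0) => [_ [? _ <-]//|]; exists c.
have sp : sublinear p.
  split=> [u v|a u a0].
    rewrite -lerBlDr; apply: lb_le_inf => // _ [c Cc <-].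
    rewrite lerBlDr -lerBlDl; apply: lb_le_inf => // _ [d Cd <-].
    rewrite lerBlDr; apply: le_trans (ple _ _ (CD _ _ Cc Cd)) _.
    by rewrite opprD addrACA addrC (le_trans (ler_normD _ _))// addrC.
  rewrite -ler_pdivrMl//; apply: lb_le_inf => // _ [c Cc <-].
  rewrite ler_pdivrMl//; apply: le_trans (ple _ _ (CZ _ _ a0 Cc)) _.
  by rewrite -scalerBr normrZ gtr0_norm.
have [l [ll lp lz]] := hahn_banach_at z sp.
have lx x : l x <= `|x| by rewrite (le_trans (lp x))// (le_trans (ple _ _ C0))// subr0.
exists l; split=> //.
- move=> x; rewrite ler_norml lx andbT lerNl.
  by rewrite -[- l x]scaleN1r -(linZ _ _ ll) scaleN1r -normrN.
- by move=> x Cx; rewrite (le_trans (lp x))// (le_trans (ple _ _ Cx))// subrr normr0.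
- rewrite lz lt_neqAle; apply/andP; split; last first.
    by apply: lb_le_inf => // _ [? _ <-].
  apply/eqP => p0; apply: Cz; apply: Ccl => A /nbhs_ballP[e /= e0 eA].
  have [|_ [c Cc <-]] := @inf_adherent _ (B z) e e0.
    by split=> //; exists 0 => _ [? _ <-].
  rewrite -/(p z) -p0 add0r => zc.
  by exists c; split=> //; apply: eA; rewrite -ball_normE.
Qed.

End HahnBanach.

(** * Weak limits in reflexive spaces *)

Section Weak.
Context {K : realType}.

Lemma dual_normP (X : normedModType K) (phi : X -> K^o) x : dual phi ->
  `|phi x| <= dual_norm phi * `|x|.
Proof.
move=> [lphi cphi].
pose L : {linear X -> K^o} := HB.pack phi (GRing.isLinear.Build K X K^o _ phi lphi).
have [M [Mr Mphi]] : \forall r \near +oo, forall x, `|L x| <= r * `|x|.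
  exact/linear_boundedP/linear_bounded_continuous.
have bphi y : `|y| <= 1 -> `|phi y| <= `|M| + 1.
  move=> y1; apply: le_trans (Mphi (`|M| + 1) _ y) _.
    by rewrite (le_lt_trans (ler_norm M))// ltrDl.
  by rewrite ler_piMr// addr_ge0.
have [->|x0] := eqVneq x 0.
  by rewrite (lin0 lphi) !normr0 mulr0.
rewrite -ler_pdivrMr ?normr_gt0//.
apply: ub_le_sup; first by exists (`|M| + 1) => _ [y /= y1 <-]; exact: bphi.
exists (`|x|^-1 *: x) => /=.
  by rewrite normrZ normfV normr_id mulVf// normr_eq0.
by rewrite (linZ _ _ lphi) normrZ normfV normr_id mulrC.
Qed.

Lemma dual_norm_ge0 (X : normedModType K) (phi : X -> K^o) : dual phi -> 0 <= dual_norm phi.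
Proof.
move=> dphi.
have [[x x0]|X0] := pselect (exists x : X, x != 0).
  have := le_trans (normr_ge0 _) (dual_normP x dphi).
  by rewrite pmulr_lge0// normr_gt0.
have [lphi _] := dphi.
rewrite /dual_norm (_ : [set _ | _ in _] = [set 0]) ?sup1//.
apply/seteqP; split=> [_ [x _ <-]|_ ->] /=.
  have [->|x0] := eqVneq x 0; last by exfalso; apply: X0; exists x.
  by rewrite (lin0 lphi) normr0.
exists 0; first by rewrite /= normr0.
by rewrite (lin0 lphi) normr0.
Qed.

Lemma dual_norm_le (X : normedModType K) (phi : X -> K^o) :
  linear phi -> (forall x, `|phi x| <= `|x|) -> dual phi.
Proof.
move=> lphi phi1; split=> //.
pose L : {linear X -> K^o} := HB.pack phi (GRing.isLinear.Build K X K^o _ phi lphi).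
apply/(@linear_bounded_continuous _ _ _ L)/linear_boundedP.
by near=> r => x; apply: le_trans (phi1 x) _; apply: ler_peMl.
Unshelve. all: by end_near. Qed.

Lemma ultra_cvg_bounded (U : set_system nat) (u : nat -> K) (M : K) :
  UltraFilter U -> (forall n, `|u n| <= M) -> exists l : K, u @ U --> l.
Proof.
move=> UU uM.
have [|l [_ cl]] := @segment_compact K (- M) M (u @ U) _.
  by apply: (@filterE _ U) => n; rewrite /= in_itv/= -ler_norml.
exists l => B Bl; have [//|nB] := in_ultra_setVsetC (u @^-1` B) UU.
by have [y [nBy /nBy]] := cl (~` B) B nB Bl.
Qed.

(* The functional phi |-> lim_U phi (d n), for an ultrafilter U, is an
   evaluation by reflexivity: x is a weak cluster point of d. *)
Lemma reflexive_weak_cluster (X : normedModType K) (d : nat -> X) (M : K) :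
  reflexive_space X -> (forall n, `|d n| <= M) ->
  exists (U : set_system nat) (x : X), [/\ ProperFilter U, \oo `<=` U &
    forall phi, dual phi -> phi \o d @ U --> (phi x : K)].
Proof.
move=> rX dM.
have [U [UU ooU]] := @ultraFilterLemma nat \oo _.
have PU : ProperFilter U := ultra_proper.
have M0 : 0 <= M by apply: le_trans (dM 0%N).
have cv phi : dual phi -> (phi \o d : nat -> K) @ U --> (lim ((phi \o d : nat -> K) @ U) : K).
  move=> dphi; have [|l] := @ultra_cvg_bounded U (phi \o d) (dual_norm phi * M) UU.
    move=> n; apply: le_trans (dual_normP _ dphi) _.
    by rewrite ler_wpM2l// dual_norm_ge0.
  by move=> ul; rewrite (cvg_lim _ ul).
have [||x xP] := rX (fun phi => lim ((phi \o d : nat -> K) @ U)).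
- move=> a phi psi dphi dpsi; apply: cvg_lim => //.
  by apply: cvgD; [apply: cvgMr; exact: cv|exact: cv].
- exists M => phi dphi.
  apply: (ler_cvg_to (cvg_norm (cv phi dphi)) (cvg_cst (M * dual_norm phi))).
  apply: filterE => n; rewrite /= mulrC; apply: le_trans (dual_normP _ dphi) _.
  by rewrite ler_wpM2l// dual_norm_ge0.
exists U, x; split; [exact: PU|exact: ooU|move=> phi dphi].
by rewrite -xP//; exact: cv.
Qed.

(* Every closed convex condition of the form A x + s \in C is weakly closed:
   if it failed at the weak cluster point, a functional separating from C would
   contradict the weak convergence. *)
Lemma reflexive_cone_limit (X Y : normedModType K) (A : {linear X -> Y})
    (C : set Y) (d : nat -> X) (r : nat -> K) (r0 : K) (s : nat -> Y) (s0 : Y) :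
  reflexive_space X -> continuous A -> cone C -> closed C ->
  (forall n, `|d n| <= r n) -> r @ \oo --> r0 -> s @ \oo --> s0 ->
  (forall n, C (A (d n) + s n)) ->
  exists2 x, `|x| <= r0 & C (A x + s0).
Proof.
move=> rX cA coneC clC dr rr0 ss0 Cn.
have [M [Mr rM]] : bounded_fun r by apply: cvg_seq_bounded; apply/cvg_ex; exists r0.
have dM n : `|d n| <= `|M| + 1.
  apply: le_trans (dr n) _; apply: le_trans (ler_norm _) _; apply: rM => //.
  by rewrite (le_lt_trans (ler_norm M))// ltrDl.
have [U [x [PU ooU xU]]] := reflexive_weak_cluster rX dM.
have rU : r @ U --> r0 by move=> B /rr0; exact: ooU.
have sU : s @ U --> s0 by move=> B /ss0; exact: ooU.
exists x.
  have [->|x0] := eqVneq x 0.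
    rewrite normr0; apply: (ler_cvg_to (cvg_cst 0) rr0); apply: filterE => n.
    exact: le_trans (dr n).
  have [|l [ll lp lx]] := @hahn_banach_at K X (fun x => `|x|) x.
    by split=> [|a y a0]; [exact: ler_normD|rewrite normrZ gtr0_norm].
  rewrite -lx.
  apply: (ler_cvg_to (xU l _) rU).
    apply: dual_norm_le => // y; rewrite ler_norml lp andbT lerNl.
    by rewrite -[- l y]scaleN1r -(linZ _ _ ll) scaleN1r -normrN.
  by apply: filterE => n /=; exact: le_trans (lp _) (dr n).
apply: contrapT => nC.
have [l [ll l1 lC lpos]] := cone_separation coneC clC nC.
have dl := dual_norm_le ll l1.
suff : l (A x + s0) <= 0 by rewrite leNgt lpos.
have cAs : (fun n => l (A (d n)) + l (s n) : K) @ U --> (l (A x) + l s0 : K).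
  apply: cvgD.
    apply: (xU (l \o A)); split.
      by move=> a u v /=; rewrite linearP ll.
    by move=> y; apply: continuous_comp; [exact: cA|exact: dl.2].
  by apply: continuous_cvg sU; exact: dl.2.
rewrite (linD _ _ ll).
apply: (ler_cvg_to cAs (cvg_cst (0 : K))).
by apply: filterE => n /=; rewrite -(linD _ _ ll) lC.
Qed.

End Weak.

(** * Mean value theorem and perturbation for cone inclusions *)

Section MeanValue.
Context {K : realType}.

Lemma is_deriveP (V W : normedModType K) (f : V -> W) a v l :
  is_derive a v f l <->
  (fun h : K => h^-1 *: (f (h *: v + a) - f a)) @ 0^' --> l.
Proof.
split=> [[dfa <-]|fl]; first exact: dfa.
by split; [apply/cvg_ex; exists l|apply: cvg_lim fl].
Qed.

Lemma is_derive_line (V W : normedModType K) (F : V -> W) x h (t : K) :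
  differentiable F (x + t *: h) ->
  is_derive t 1 (fun s : K => F (x + s *: h)) ('d F (x + t *: h) h).
Proof.
move=> dF; apply/is_deriveP.
have /is_deriveP : is_derive (x + t *: h) h F ('d F (x + t *: h) h).
  by split; [exact: diff_derivable|exact: deriveE].
apply: cvg_trans; apply: near_eq_cvg; near=> s.
by rewrite -[s *: 1]/(s * 1) mulr1 scalerDl addrCA.
Unshelve. all: by end_near. Qed.

Lemma is_derive_pair (V W : normedModType K) (f : K -> V) (g : K -> W) (t : K) df dg :
  is_derive t 1 f df -> is_derive t 1 g dg ->
  is_derive t 1 (fun s => (f s, g s)) (df, dg).
Proof.
move=> /is_deriveP fd /is_deriveP gd; apply/is_deriveP.
exact: cvg_pair fd gd.
Qed.

Lemma cone_mean_value (V : normedModType K) (D : set V) (c dc : K -> V) :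
  cone D -> closed D -> (forall t : K, 0 <= t <= 1 -> is_derive t 1 c (dc t)) ->
  (forall t : K, 0 < t < 1 -> D (dc t)) -> D (c 1 - c 0).
Proof.
move=> coneD clD cdc Ddc; apply: contrapT => nD.
have [l [ll l1 lD lpos]] := cone_separation coneD clD nD.
have [_ cl] := dual_norm_le ll l1.
have d (t : K) : 0 <= t <= 1 -> is_derive t (1 : K) (l \o c : K -> K) (l (dc t)).
  move=> /cdc/is_deriveP ct; apply/is_deriveP.
  have := cvg_comp _ _ ct (cl (dc t)).
  apply: cvg_trans; apply: near_eq_cvg; near=> s.
  rewrite /= (linZ _ _ ll); congr (_ *: _).
  by rewrite -scaleN1r (linD _ _ ll) (linZ _ _ ll) scaleN1r.
have [||t t01] := @MVT K (l \o c) (l \o dc) 0 1 ltr01.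
- by move=> t; rewrite in_itv/= => /andP[t0 t1]; apply: d; rewrite !ltW.
- by apply: derivable_within_continuous => t; rewrite in_itv/= => /d [].
rewrite subr0 mulr1 /= => E.
have : l (c 1 - c 0) <= 0.
  rewrite -scaleN1r (linD _ _ ll) (linZ _ _ ll) scaleN1r E.
  by apply/lD/Ddc; rewrite in_itv/= in t01.
by rewrite leNgt lpos.
Unshelve. all: by end_near. Qed.

Lemma closed_seq (V : normedModType K) (D : set V) :
  (forall (u : nat -> V) x, (forall n, D (u n)) -> u @ \oo --> x -> D x) ->
  closed D.
Proof.
move=> H x xD.
have /choice[u uP] n : exists y, D y /\ ball x n.+1%:R^-1 y.
  have [|y [Dy xy]] := xD (ball x n.+1%:R^-1) _; last by exists y.
  exact: nbhsx_ballx.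
apply: (H u) => [n|]; first exact: (uP n).1.
apply/cvgrPdist_lt => e e0; near=> n.
have := (uP n).2; rewrite -ball_normE/= => /lt_trans; apply.
by near: n; exact: near_infty_natSinv_lt (PosNum e0).
Unshelve. all: by end_near. Qed.

End MeanValue.

Section ConeSolve.
Context {K : realType} {X Y : normedModType K}.
Implicit Types (A : {linear X -> Y}) (C : set Y).

(* ||T^-1 y|| <= r with the infimum attained, where T d = A d - C. *)
Definition solvable A C y r := exists2 d, `|d| <= r & C (A d - y).

Lemma solvable_cone A C :
  cone C -> cone [set p : Y * K^o | solvable A C p.1 p.2].
Proof.
move=> [C0 CD CZ]; split => /=.
- by exists 0; rewrite ?normr0// linear0 subr0.
- move=> [y r] [z s] [d dr Cd] [e es Ce] /=; exists (d + e).
    by rewrite (le_trans (ler_normD _ _))// lerD.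
  by rewrite linearD opprD addrACA; exact: CD.
- move=> a [y r] a0 [d dr Cd] /=; exists (a *: d).
    by rewrite normrZ gtr0_norm// -[_ *: r]/(a * r) ler_pM2l.
  by rewrite linearZ -scalerBr; exact: CZ.
Qed.

Lemma solvable_le A C y r s : r <= s -> solvable A C y r -> solvable A C y s.
Proof. by move=> rs [d dr Cd]; exists d => //; exact: le_trans rs. Qed.

Lemma solvable_closed A C : reflexive_space X -> continuous A -> cone C -> closed C ->
  closed [set p : Y * K^o | solvable A C p.1 p.2].
Proof.
move=> rX cA coneC clC; apply: closed_seq => u [y r] uD uyr /=.
have /choice[d dP] n : exists d, `|d| <= (u n).2 /\ C (A d - (u n).1).
  by have [d] := uD n; exists d.
have [||||x xr Cx] := @reflexive_cone_limit K X Y A C d (snd \o u) r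
    (fun n => - (u n).1) (- y) rX cA coneC clC.
- by move=> n; have [] := dP n.
- exact: (cvg_comp _ _ uyr cvg_snd).
- by apply: cvgN; exact: (cvg_comp _ _ uyr cvg_fst).
- by move=> n; have [] := dP n.
by exists x.
Qed.

(* Neumann series: e_(n+1) solves the inclusion for the residual (A - A0) e_n. *)
Lemma solvable_perturb A0 A C q w :
  reflexive_space X -> continuous A0 -> continuous A -> cone C -> closed C ->
  0 <= q < 1 -> (forall h, solvable A0 C (A h - A0 h) (q * `|h|)) ->
  solvable A C (A0 w) (`|w| / (1 - q)).
Proof.
move=> rX cA0 cA coneC clC /andP[q0 q1] Aq; have [C0 CD CZ] := coneC.
have /choice[T TP] h : exists e, `|e| <= q * `|h| /\ C (A0 e + (A h - A0 h)).
  have [e eh Ce] := Aq (- h); exists e; rewrite normrN in eh; split=> //.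
  by move: Ce; rewrite !linearN opprD !opprK [A h - _]addrC.
pose e n := iter n T w; pose d n := \sum_(i < n.+1) e i.
have eq n : `|e n| <= q ^+ n * `|w|.
  elim: n => [|n IH]; first by rewrite expr0 mul1r.
  rewrite exprS -mulrA /=; apply: le_trans (TP (e n)).1 _.
  by rewrite ler_wpM2l.
have e0 : e @ \oo --> 0.
  apply/norm_cvg0P; apply: (@squeeze_cvgr _ _ _ _ (fun=> 0) (fun n => q ^+ n * `|w|)).
  - by apply: nearW => n; rewrite normr_ge0 eq.
  - exact: cvg_cst.
  - rewrite -[X in _ --> X](mul0r `|w|); apply: cvgMl.
    by apply: cvg_expr; rewrite ger0_norm.
have [||||x xr Cx] := @reflexive_cone_limit K X Y A C d
    (fun=> `|w| / (1 - q)) (`|w| / (1 - q))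
    (fun n => - A0 w - (A (e n) - A0 (e n))) (- A0 w) rX cA coneC clC.
- move=> n; rewrite ler_pdivlMr ?subr_gt0//.
  have : `|d n| <= \sum_(i < n.+1) q ^+ i * `|w|.
    by rewrite (le_trans (ler_norm_sum _ _ _))// ler_sum.
  rewrite -mulr_suml => /(ler_wpM2r (_ : 0 <= 1 - q)); rewrite subr_ge0 => /(_ (ltW q1)).
  move/le_trans; apply.
  rewrite mulrAC mulrC -[leRHS]mulr1 ler_wpM2l//.
  have := subrX1 q n.+1; move: (exprn_ge0 n.+1 q0); set S := \sum_(i < _) _ => qn ES.
  by lra.
- exact: cvg_cst.
- rewrite -[X in _ --> X]subr0; apply: cvgB; first exact: cvg_cst.
  rewrite -[X in _ --> X](subrr 0); apply: cvgB.
    by rewrite -(linear0 A); apply: continuous_cvg e0; exact: cA.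
  by rewrite -(linear0 A0); apply: continuous_cvg e0; exact: cA0.
- elim=> [|n IH]; first by rewrite /d big_ord1 /= opprB !addrA subrK subrr.
  rewrite (_ : _ + _ = A (d n) + (- A0 w - (A (e n) - A0 (e n))) +
      (A0 (e n.+1) + (A (e n) - A0 (e n)))).
    exact: CD IH (TP (e n)).2.
  rewrite {1}/d big_ord_recr/= -/(d n) linearD.
  have E u v y z b : u + v + (y - (v - b)) = u + (y - z) + (b + z) :> Y.
    by rewrite opprB addrACA [v + _]addrC subrK [b + z]addrC addrA -[u + _ + z]addrA subrK.
  exact: E.
by exists x.
Qed.

End ConeSolve.

(** * One-sided derivatives *)

Section OneSided.
Context {K : realType}.
Implicit Types (f df : K -> K) (R a b : K).

Lemma cvg_withinP (A : set K) (q : K -> K) u l :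
  (q s @[s --> within A u^'] --> l) <->
  forall e : K, 0 < e -> exists2 d : K, 0 < d &
    forall s : K, A s -> s != u -> `|s - u| < d -> `|l - q s| < e.
Proof.
split=> [/cvgrPdist_lt H e /H|H].
  rewrite near_withinE /= => /nbhs_ballP[d /= d0 dP]; exists d => // s As su sd.
  by apply: dP => //; rewrite -ball_normE/= distrC.
apply/cvgrPdist_lt => e /H[d d0 dP].
rewrite near_withinE; apply/nbhs_ballP; exists d => //= s.
by rewrite -ball_normE/= distrC => sd su As; apply: dP.
Qed.

Lemma is_derive_quotP f u l : is_derive u (1 : K) f l <->
  forall e : K, 0 < e -> exists2 d : K, 0 < d &
    forall s : K, s != u -> `|s - u| < d -> `|l - (f s - f u) / (s - u)| < e.
Proof.
split=> [/is_deriveP/cvgrPdist_lt H e /H|H].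
  move=> /nbhs_ballP[d /= d0 dP]; exists d => // s su sd.
  have := dP (s - u); rewrite -ball_normE/= distrC subr0 subr_eq0 => /(_ sd su).
  by rewrite -[(s - u) *: 1]/((s - u) * 1) mulr1 subrK -[_ *: _]/(_ * _) mulrC.
apply/is_deriveP/cvgrPdist_lt => e /H[d d0 dP].
apply/nbhs_ballP; exists d => //= s; rewrite -ball_normE/= distrC subr0 => sd s0.
have := dP (s + u); rewrite addrK -subr_eq0 addrK => /(_ s0 sd).
by rewrite -[s *: 1]/(s * 1) mulr1 -[_ *: _]/(_ * _) [s^-1 * _]mulrC.
Qed.

(* f' = df on [0, R[, one-sided at 0; the extension makes the endpoint 0
   interior. *)
Definition has_derivative R f df : Prop :=
  exists fe dfe : K -> K, (forall u : K, u < R -> is_derive u 1 fe (dfe u)) /\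
    forall u : K, 0 <= u < R -> f u = fe u /\ df u = dfe u.

Lemma derivable_on_has_derivative R f : 0 < R ->
  (forall t : K, `[0, R[%classic t -> derivable_on `[0, R[ f t) ->
  has_derivative R f (derive_on `[0, R[ f).
Proof.
move=> R0 fd; set df := derive_on _ f.
have fd' (u : K) : 0 <= u < R -> forall e : K, 0 < e -> exists2 d : K, 0 < d &
    forall s : K, 0 <= s < R -> s != u -> `|s - u| < d -> `|df u - (f s - f u) / (s - u)| < e.
  move=> uR; have := fd u; rewrite /= in_itv/= => /(_ uR)/cvg_withinP H e /H[d d0 dP].
  by exists d => // s sR; apply: dP; rewrite /= in_itv.
pose fe (u : K) := if u < 0 then f 0 + df 0 * u else f u.
exists fe, (fun u : K => df (Num.max u 0)); split=> u; last first.
  by move=> /andP[u0 uR] /=; rewrite /fe ltNge u0 /= max_l.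
move=> uR; apply/is_derive_quotP => e e0.
have [u0|u0|u0] := ltgtP u 0.
- exists (- u); first by lra.
  move=> s su sd.
  have s0 : s < 0 by move: sd; rewrite ltr_norml => /andP[? ?]; lra.
  rewrite /fe s0 u0 (_ : _ - (f 0 + _) = df 0 * (s - u)); last by ring.
  by rewrite mulfK ?subr_eq0// subrr normr0.
- have [|d d0 dP] := fd' u _ e e0; first by rewrite ltW.
  exists (Num.min d (Num.min u (R - u))); first by rewrite !lt_min d0 u0 subr_gt0.
  move=> s su; rewrite !lt_min => /and3P[sd s1 s2].
  move: s1 s2 => /ltr_normlP[s1 _] /ltr_normlP[_ s2].
  have s0 : 0 < s by lra.
  rewrite /fe (lt_gtF s0) (lt_gtF u0); apply: dP => //.
  by rewrite (ltW s0)/=; lra.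
- rewrite {}u0 in uR *; have [|d d0 dP] := fd' 0 _ e e0; first by rewrite lexx.
  exists (Num.min d R); first by rewrite lt_min d0.
  move=> s su; rewrite lt_min => /andP[sd sR]; rewrite /fe ltxx.
  have [s0|s0] := ltP s 0.
    by rewrite addrAC subrr add0r subr0 mulfK// subrr normr0.
  apply: dP => //; rewrite s0 /=; move: sR => /ltr_normlP[]; lra.
Qed.

Lemma within_proper R u : 0 <= u < R -> ProperFilter (within `[0, R[ u^').
Proof.
move=> /andP[u0 uR]; apply: Build_ProperFilter_ex.
move=> P; rewrite /within/= => /nbhs_ballP[d /= d0 dP].
pose s := u + Num.min (d / 2) ((R - u) / 2).
have m0 : 0 < Num.min (d / 2) ((R - u) / 2) by rewrite lt_min; apply/andP; split; lra.
have m1 : Num.min (d / 2) ((R - u) / 2) <= d / 2 by rewrite ge_min lexx.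
have m2 : Num.min (d / 2) ((R - u) / 2) <= (R - u) / 2 by rewrite ge_min lexx orbT.
exists s; apply: (dP s).
- rewrite -ball_normE/= /s opprD addNKr normrN gtr0_norm//; lra.
- by rewrite /s gt_eqF// ltrDl.
- by rewrite /= in_itv/= /s; apply/andP; split; lra.
Qed.

Lemma has_derivative_derive_on R f df t : has_derivative R f df -> 0 <= t < R ->
  derivable_on `[0, R[ f t /\ derive_on `[0, R[ f t = df t.
Proof.
move=> [fe [dfe [H E]]] tR; have /andP[t0 tR'] := tR.
have : ((f s - f t) / (s - t)) @[s --> within `[0, R[ t^'] --> df t.
  apply/cvg_withinP => e e0.
  have /is_derive_quotP/(_ e e0)[d d0 dP] := H t tR'.
  exists d => // s; rewrite /= in_itv/= => sR su sd.
  by have [-> _] := E s sR; have [-> ->] := E t tR; exact: dP.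
move=> cv; have PF := within_proper tR; split; first by apply/cvg_ex; exists (df t).
exact: cvg_lim cv.
Qed.

Lemma has_derivative_continuous R f df b : has_derivative R f df -> b < R ->
  {within `[0, b], continuous f}.
Proof.
move=> [fe [dfe [H E]]] bR.
apply: (@subspace_eq_continuous _ `[0, b]%classic K fe f).
  move=> u; rewrite inE/= in_itv/= => /andP[u0 ub].
  by have [|-> _] := E u; rewrite ?u0/= ?(le_lt_trans ub).
apply: derivable_within_continuous => u; rewrite in_itv/= => /andP[u0 ub].
by have [] := H u (le_lt_trans ub bR).
Qed.

Lemma has_derivative_mvt R f df a b : has_derivative R f df -> 0 <= a -> a < b -> b < R ->
  exists2 c, a < c < b & f b - f a = df c * (b - a).
Proof.
move=> [fe [dfe [H E]]] a0 ab bR.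
have [||c] := @MVT K fe dfe a b ab.
- by move=> u; rewrite in_itv/= => /andP[au ub]; apply: H; exact: lt_trans bR.
- apply: derivable_within_continuous => u; rewrite in_itv/= => /andP[u0 ub].
  by have [] := H u (le_lt_trans ub bR).
rewrite in_itv/= => cab Ec; exists c => //; have /andP[ac cb] := cab.
have [|-> _] := E b; first by lra.
have [|-> _] := E a; first by lra.
by have [|_ ->] := E c; first by lra.
Qed.

End OneSided.

(** * Newton's method for a convex majorant *)

Section ScalarNewton.
Context {K : realType}.
Implicit Types (f df : K -> K) (R : K).

Definition convex_on R df : Prop := forall a b c : K,
  0 <= a -> a <= b -> b <= c -> c < R ->
  df b * (c - a) <= df a * (c - b) + df c * (b - a).

Definition increasing_on R df : Prop := forall a b : K,
  0 <= a -> a < b -> b < R -> df a < df b.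

Lemma convex_function_on R df :
  convex_function (`[0, R[%classic : set K) df -> convex_on R df.
Proof.
move=> cv a b c a0 ab bc cR.
have [/eqP ac|ac] := eqVneq a c.
  have -> : b = a by apply/eqP; rewrite eq_le ab (eqP ac) bc.
  by rewrite (eqP ac) subrr !mulr0 addr0.
have ca0 : 0 < c - a by rewrite subr_gt0 lt_neqAle ac (le_trans ab).
have p01 : 0 <= (c - b) / (c - a) <= 1.
  by rewrite divr_ge0 ?ler_pdivrMr//= ?mul1r; lra.
pose p : {i01 K} := Itv01 (proj1 (andP p01)) (proj2 (andP p01)).
have := cv p a c; rewrite !inE/= !in_itv/=.
have -> : 0 <= a < R by lra.
have -> : 0 <= c < R by lra.
move=> /(_ isT isT).
have E : (conv p (a : K^o) c : K^o) = b.
  by rewrite convRE /= /unstable.onem; field; lra.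
rewrite [X in df X]E convRE /= /unstable.onem -(ler_pM2r ca0) => /le_trans; apply.
by rewrite le_eqVlt; apply/orP; left; apply/eqP; field; lra.
Qed.

Lemma convex_on_incr R df a b s : convex_on R df ->
  0 <= a -> a <= b -> 0 <= s -> b + s < R ->
  df (a + s) - df a <= df (b + s) - df b.
Proof.
move=> cv a0 ab s0 bR.
have [L0|L0] := eqVneq (b + s - a) 0.
  have -> : s = 0 by lra.
  by rewrite !addr0 !subrr.
have Lp : 0 < b + s - a by rewrite lt_neqAle eq_sym L0/=; lra.
rewrite -(ler_pM2r Lp).
have := cv a (a + s) (b + s) ltac:(lra) ltac:(lra) ltac:(lra) ltac:(lra).
have := cv a b (b + s) ltac:(lra) ltac:(lra) ltac:(lra) ltac:(lra).
by lra.
Qed.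

Lemma convex_on_slope R df a s b r : convex_on R df ->
  0 <= a -> a <= b -> 0 <= s -> s <= r -> b + r < R ->
  (df (a + s) - df a) * r <= (df (b + r) - df b) * s.
Proof.
move=> cv a0 ab s0 sr bR.
have H1 : df (a + s) - df a <= df (b + s) - df b by apply: (convex_on_incr cv) => //; lra.
have := cv b (b + s) (b + r) ltac:(lra) ltac:(lra) ltac:(lra) ltac:(lra).
have : (df (a + s) - df a) * r <= (df (b + s) - df b) * r.
  by rewrite ler_wpM2r//; lra.
by lra.
Qed.

Lemma increasing_on_le R df a b : increasing_on R df ->
  0 <= a -> a <= b -> b < R -> df a <= df b.
Proof. by move=> inc a0; rewrite le_eqVlt => /predU1P[->//|ab bR]; exact/ltW/inc. Qed.

Lemma tangent_lt R f df a b : has_derivative R f df -> increasing_on R df ->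
  0 <= a -> a < b -> b < R -> f a + df a * (b - a) < f b.
Proof.
move=> hd inc a0 ab bR.
have [c /andP[ac cb] E] := has_derivative_mvt hd a0 ab bR.
rewrite -ltrBrDl E ltr_pM2r ?subr_gt0//; apply: inc => //; exact: lt_trans bR.
Qed.

Lemma tangent_le R f df a b : has_derivative R f df -> increasing_on R df ->
  0 <= a -> a <= b -> b < R -> f a + df a * (b - a) <= f b.
Proof.
move=> hd inc a0; rewrite le_eqVlt => /predU1P[->|ab] bR.
  by rewrite subrr mulr0 addr0.
exact/ltW/(tangent_lt hd).
Qed.

Lemma trapezoid R f df a b : has_derivative R f df -> convex_on R df ->
  0 <= a -> a < b -> b < R ->
  f b - f a - df a * (b - a) <= (df b - df a) * (b - a) / 2.
Proof.
move=> [fe [dfe [H E]]] cv a0 ab bR.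
pose k := (df b - df a) / (b - a) / 2.
pose p : K -> K := fe - (k \*: ((id : K -> K) - cst a) ^+ 2).
have d u : u < R -> is_derive u (1 : K) p
    (dfe u - 2 * k * (u - a)).
  move=> uR; have Hu := H u uR; apply: is_derive_eq.
  rewrite /= -![_ *: _]/(_ * _) /= expr1 subr0 !fctE /=; ring.
have [||c] := @MVT K p (fun u => dfe u - 2 * k * (u - a)) a b ab.
- by move=> u; rewrite in_itv/= => /andP[au ub]; apply: d; exact: lt_trans bR.
- apply: derivable_within_continuous => u; rewrite in_itv/= => /andP[u0 ub].
  by have [] := d u (le_lt_trans ub bR).
rewrite in_itv/= => /andP[ac cb].
have [|-> _] := E b; first by lra.
have [|-> _] := E a; first by lra.
have [|_ dfc] := E c; first by lra.
have pE u : p u = fe u - k * (u - a) ^+ 2 by [].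
rewrite /= !pE -dfc => Eq.
have := cv a c b a0 (ltW ac) (ltW cb) bR.
have k2 : 2 * k * (b - a) = df b - df a by rewrite /k; field; lra.
move=> C; have : (df c - df a - 2 * k * (c - a)) * (b - a) <= 0 by nra.
by nra.
Qed.

Lemma left_derive_slope R df s : convex_on R df -> increasing_on R df ->
  0 < s -> s < R ->
  forall a, 0 <= a -> a < s -> (df s - df a) / (s - a) <= left_derive df s.
Proof.
move=> cv inc s0 sR.
pose q a := (df s - df a) / (s - a).
have qmono a b : 0 <= a -> a <= b -> b < s -> q a <= q b.
  move=> a0 ab bs; rewrite /q ler_pdivrMr ?subr_gt0 ?(le_lt_trans ab)//.
  rewrite mulrAC ler_pdivlMr ?subr_gt0//.
  have := cv a b s a0 ab (ltW bs) sR.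
  by nra.
pose v := (s + R) / 2.
pose A := [set q a | a in [set a | 0 <= a < s]].
have Aub a : 0 <= a -> a < s -> q a <= (df v - df s) / (v - s).
  move=> a0 as_; rewrite /q ler_pdivrMr ?subr_gt0//.
  have vs : 0 < v - s by rewrite /v; lra.
  rewrite mulrAC ler_pdivlMr//.
  have := cv a s v a0 (ltW as_) ltac:(rewrite /v; lra) ltac:(rewrite /v; lra).
  by nra.
have supA : has_sup A.
  split; first by exists (q 0), 0 => //=; rewrite lexx.
  by exists ((df v - df s) / (v - s)) => _ [a /andP[a0 as_] <-]; exact: Aub.
have qsup a : 0 <= a -> a < s -> q a <= sup A.
  by move=> a0 as_; apply: (ub_le_sup supA.2); exists a => //=; rewrite a0.
have cvq : q a @[a --> s^'-] --> sup A.
  apply/cvgrPdist_lt => e e0.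
  have [_ [a0 /andP[a00 a0s] <-] a0e] := sup_adherent e0 supA.
  near=> a.
  have a0a : a0 < a by near: a; exact: nbhs_left_gt.
  have as_ : a < s by near: a; exact: nbhs_left_lt.
  have := qmono a0 a a00 (ltW a0a) as_.
  have := qsup a (le_trans a00 (ltW a0a)) as_.
  by move=> ? ?; apply/ltr_normlP; split; lra.
have -> : left_derive df s = sup A by exact: cvg_lim cvq.
exact: qsup.
Unshelve. all: by end_near. Qed.

Section Sequence.
Context (f df : K -> K) (R : K).
Hypothesis fd : has_derivative R f df.
Hypothesis cv : convex_on R df.
Hypothesis inc : increasing_on R df.

Lemma smallest_zero_exists t0 : 0 < f 0 -> 0 < t0 < R -> f t0 < 0 ->
  exists2 ts, [/\ 0 < ts < R, f ts = 0 & df ts < 0] &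
    forall s, 0 <= s < ts -> 0 < f s.
Proof.
move=> f0 /andP[t00 t0R] ft0.
have [|ts] := @IVT K f 0 t0 0 (ltW t00) (has_derivative_continuous fd t0R).
  by rewrite ge_min (ltW ft0) orbT le_max (ltW f0).
rewrite in_itv/= => /andP[ts0 tst0] fts.
have tslt : ts < t0.
  by rewrite lt_neqAle tst0 andbT; apply: contraTneq ft0 => <-; rewrite fts ltxx.
have tsgt : 0 < ts.
  by rewrite lt_neqAle ts0 andbT; apply/eqP => E; move: f0; rewrite {2}E fts ltxx.
have [c /andP[tsc ct0] Ec] := has_derivative_mvt fd ts0 tslt t0R.
have dfc : df c < 0.
  by rewrite -(pmulr_llt0 _ (_ : 0 < t0 - ts)) ?subr_gt0// -Ec fts subr0.
have dfts : df ts < df c by apply: inc => //; exact: lt_trans t0R.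
exists ts; first by split=> //; [rewrite tsgt (lt_trans tslt)|exact: lt_trans dfc].
move=> s /andP[s0 sts].
have := tangent_lt fd inc s0 sts (lt_trans tslt t0R).
have dfs : df s < df ts by apply: inc => //; exact: lt_trans t0R.
have : df s * (ts - s) < 0 by rewrite nmulr_rlt0 ?subr_gt0//; lra.
rewrite fts.
have [d /andP[sd dts] Ed] := has_derivative_mvt fd s0 sts (lt_trans tslt t0R).
have dfd : df d < df ts by apply: inc => //; [exact: le_trans s0 (ltW sd)|exact: lt_trans t0R].
have : df d * (ts - s) < 0 by rewrite nmulr_rlt0 ?subr_gt0//; lra.
by rewrite -Ed fts sub0r oppr_lt0.
Qed.

Context (ts D : K).
Hypothesis tsR : 0 < ts < R.
Hypothesis fts : f ts = 0.
Hypothesis dfts : df ts < 0.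
Hypothesis fpos : forall s, 0 <= s < ts -> 0 < f s.
Hypothesis slopeD : forall a, 0 <= a -> a < ts -> (df ts - df a) / (ts - a) <= D.

Lemma df_lt u : 0 <= u < ts -> df u < df ts.
Proof. by move=> /andP[u0 uts]; apply: inc => //; have /andP[] := tsR. Qed.

Lemma newton_step_scalar u : 0 <= u < ts ->
  let n := u - f u / df u in
  [/\ df u < 0, u < n < ts, ts - n <= (ts - u) / 2 &
      ts - n <= D / (- 2 * df ts) * (ts - u) ^+ 2].
Proof.
move=> uts n; have /andP[u0 ut] := uts; have /andP[ts0 tsR'] := tsR.
have dts := dfts; have du := df_lt uts; have fu := fpos uts.
have dun : df u != 0 by apply: ltr0_neq0; exact: lt_trans dfts.
have wE : (n - u) * df u = - f u by rewrite /n; field.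
have tan := tangent_lt fd inc u0 ut tsR'.
have tra := trapezoid fd cv u0 ut tsR'.
have sD := slopeD u0 ut; rewrite ler_pdivrMr ?subr_gt0// in sD.
rewrite fts in tan tra.
have n1 : u < n by nra.
have n2 : n < ts by nra.
have n3 : - df u * (ts - n) <= (df ts - df u) * (ts - u) / 2 by lra.
split; [lra|by rewrite n1 n2| |].
  rewrite -(ler_pM2l (_ : 0 < - df u)); [nra|lra].
have n4 : - df ts * (ts - n) <= - df u * (ts - n) by rewrite ler_pM2r; lra.
have n5 : (df ts - df u) * (ts - u) <= D * (ts - u) * (ts - u) by rewrite ler_pM2r; lra.
rewrite mulrAC ler_pdivlMr; last by lra.
by lra.
Qed.

Context (t : nat -> K).
Hypothesis t0 : t 0%N = 0.
Hypothesis tS : forall k, t k.+1 = t k - f (t k) / df (t k).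

Lemma newton_in k : 0 <= t k < ts.
Proof.
elim: k => [|k IH]; first by rewrite t0 lexx; have /andP[] := tsR.
have [_ /andP[n1 n2] _ _] := newton_step_scalar IH.
by rewrite tS n2 andbT; have /andP[] := IH; lra.
Qed.

Lemma newton_lt k : t k < t k.+1.
Proof. by have [_ /andP[n1 _] _ _] := newton_step_scalar (newton_in k); rewrite tS. Qed.

Lemma newton_df k : df (t k) < 0.
Proof. by have [] := newton_step_scalar (newton_in k). Qed.

Lemma newton_half k : ts - t k.+1 <= (ts - t k) / 2.
Proof. by have [_ _ h _] := newton_step_scalar (newton_in k); rewrite tS. Qed.

Lemma newton_quadratic k : ts - t k.+1 <= D / (- 2 * df ts) * (ts - t k) ^+ 2.
Proof. by have [_ _ _ h] := newton_step_scalar (newton_in k); rewrite tS. Qed.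

Lemma newton_cvg : t @ \oo --> ts.
Proof.
have H k : ts - t k <= (1 / 2) ^+ k * ts.
  elim: k => [|k IH]; first by rewrite t0 expr0; lra.
  by have := newton_half k; rewrite exprS; lra.
have c0 : (fun k => (1 / 2) ^+ k * ts : K) @ \oo --> (0 : K).
  rewrite -[X in _ --> X](mul0r ts); apply: cvgMl.
  by apply: cvg_expr; rewrite ger0_norm; lra.
apply: (@squeeze_cvgr _ _ _ _ (fun k => ts - (1 / 2) ^+ k * ts) (fun=> ts)).
- by apply: nearW => k; have := H k; have /andP[_] := newton_in k; lra.
- by rewrite -[X in _ --> X]subr0; apply: cvgB => //; exact: cvg_cst.
- exact: cvg_cst.
Qed.

Lemma newton_error k :
  (t k.+2 - t k.+1) * - df (t k.+1) =
  f (t k.+1) - f (t k) - df (t k) * (t k.+1 - t k).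
Proof.
have E k' : (t k'.+1 - t k') * df (t k') = - f (t k').
  by rewrite tS; have := newton_df k' => h; field; rewrite lt_eqF.
by have := E k; have := E k.+1; lra.
Qed.

Lemma newton_ratio k :
  (t k.+2 - t k.+1) / (t k.+1 - t k) ^+ 2 <= D / (- 2 * df ts).
Proof.
have /andP[a0 at_] := newton_in k; have /andP[b0 bt] := newton_in k.+1.
have ab := newton_lt k; have bc := newton_lt k.+1; have /andP[ts0 tsR'] := tsR.
have dts := dfts; have Ek := newton_error k; have db := df_lt (newton_in k.+1).
have tra := trapezoid fd cv a0 ab (lt_trans bt tsR').
have sD := slopeD a0 at_; rewrite ler_pdivrMr ?subr_gt0// in sD.
have conv := cv a0 (ltW ab) (ltW bt) tsR'.
move: ab bc at_ bt Ek db tra sD conv; set a := t k; set b := t k.+1; set c := t k.+2.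
move=> ab bc at_ bt Ek db tra sD conv.
have s1 : df b - df a <= D * (b - a).
  rewrite -(ler_pM2r (_ : 0 < ts - a)); last by lra.
  by nra.
rewrite ler_pdivrMr; last by rewrite exprn_gt0// subr_gt0.
rewrite mulrAC ler_pdivlMr; last by lra.
have : (c - b) * - df ts <= (c - b) * - df b by rewrite ler_pM2l; lra.
have : (df b - df a) * (b - a) <= D * (b - a) * (b - a) by rewrite ler_pM2r; lra.
by lra.
Qed.

End Sequence.
End ScalarNewton.

(** * The majorant condition *)

Section Calculus.
Context {K : realType}.

Lemma is_derive_line_real (f : K -> K) a r l (t : K) :
  is_derive (a + t * r) 1 f l -> is_derive t 1 (fun s => f (a + s * r)) (r * l).
Proof.
move=> [df fl]; have dF : differentiable f (a + t *: r) by exact/derivable1_diffP.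
have -> : r * l = 'd f (a + t *: r) r.
  have <- : r *: 'd f (a + t *: r) 1 = 'd f (a + t *: r) r.
    by rewrite -linearZ /= -[r *: 1]/(r * 1) mulr1.
  by rewrite -deriveE// -[t *: r]/(t * r) fl.
exact: is_derive_line dF.
Qed.

Lemma cvg_add_harmonic (r : K) : (fun n => r + n.+1%:R^-1 : K) @ \oo --> r.
Proof.
rewrite -[X in _ --> X]addr0; apply: cvgD; first exact: cvg_cst.
exact: cvg_harmonic.
Qed.

End Calculus.

Section Inclusion.
Context {K : realType} {X Y : normedModType K}.
Context (Omega : set X) (F : X -> Y) (C : set Y).
Hypothesis rX : reflexive_space X.
Hypothesis C1F : C1_frechet Omega F.
Hypothesis coneC : closed_convex_cone C.

Lemma closed_convex_coneP : cone C /\ closed C.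
Proof.
have [[y0 Cy0] clC cvC CZ] := coneC.
have CD x y : C x -> C y -> C (x + y).
  move=> Cx Cy.
  have h0 : 0 <= 2^-1 :> K by rewrite invr_ge0.
  have h1 : 2^-1 <= 1 :> K by rewrite invf_le1// ler1n.
  have := cvC x y (Itv01 h0 h1).
  rewrite !inE => /(_ Cx Cy) /(CZ 2 _ (ltr0n _ _)).
  rewrite /conv/= /unstable.onem scalerDr !scalerA divff ?pnatr_eq0//.
  by rewrite mulrBr divff ?pnatr_eq0// mulr1 (_ : 2 - 1 = 1) ?scale1r//; ring.
split=> //; split=> //.
apply: (@closed_cvg _ _ \oo _ (fun n => n.+1%:R^-1 *: y0) C) => //.
  by apply: nearW => n; apply: CZ => //; rewrite invr_gt0.
by rewrite -[X in _ --> X](scale0r y0); apply: cvgZr_tmp; exact: cvg_harmonic.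
Qed.

Let cC : cone C := closed_convex_coneP.1.
Let clC : closed C := closed_convex_coneP.2.

Lemma set_norm_solvable z y r : differentiable F z ->
  (set_norm (Tinv F C z y) <= r%:E)%E -> solvable ('d F z) C y r.
Proof.
move=> dF yr.
have /choice[d dP] n : exists d, `|d| <= r + n.+1%:R^-1 /\ C ('d F z d - y).
  have : (set_norm (Tinv F C z y) < (r + n.+1%:R^-1)%:E)%E.
    by apply: le_lt_trans yr _; rewrite lte_fin ltrDl invr_gt0.
  move=> /ereal_inf_lt[_ [d + <-]]; rewrite TinvE lte_fin => Cd /ltW dr.
  by exists d.
have [||||x xr Cx] := @reflexive_cone_limit K X Y ('d F z) C d
  (fun n => r + n.+1%:R^-1) r (fun=> - y) (- y) rX (diff_continuous dF) cC clC.
- by move=> n; have [] := dP n.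
- exact: cvg_add_harmonic.
- exact: cvg_cst.
- by move=> n; have [] := dP n.
by exists x.
Qed.

Lemma robinson_solvable z y : robinson F C z -> exists d, C ('d F z d - y).
Proof.
move=> rob; have : svrge (T_ F C z) y by rewrite rob.
by move=> [d _ [c Cc <-]]; exists d; rewrite subKr.
Qed.

Lemma svnorm_solvable z (B : X -> Y) r h : differentiable F z -> robinson F C z ->
  linear B -> (svnorm (fun d => Tinv F C z (B d)) <= r%:E)%E ->
  solvable ('d F z) C (B h) (r * `|h|).
Proof.
move=> dF rob lB Br.
have [->|h0] := eqVneq h 0.
  by rewrite (lin0 lB) normr0 mulr0; exists 0; rewrite ?normr0// linear0 subr0; have [] := cC.
have n0 : 0 < `|h| by rewrite normr_gt0.
have [d dr Cd] : solvable ('d F z) C (B (`|h|^-1 *: h)) r.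
  apply: set_norm_solvable => //; apply: le_trans Br.
  apply: ereal_sup_ubound; exists (`|h|^-1 *: h) => //; split => /=.
    by have [d Cd] := robinson_solvable (B (`|h|^-1 *: h)) rob; exists d; rewrite TinvE.
  by rewrite normrZ normfV normr_id mulVf// normr_eq0.
exists (`|h| *: d).
  by rewrite normrZ normr_id mulrC ler_pM2r.
rewrite linearZ (_ : B h = `|h| *: B (`|h|^-1 *: h)).
  by rewrite -scalerBr; have [_ _] := cC; exact.
by rewrite (linZ _ _ lB) scalerA divff ?scale1r// gt_eqF.
Qed.

Section Majorant.
(* A majorant condition at z with the infima attained. *)
Definition majorizes z R (df : K -> K) : Prop :=
  forall x y, ball z R x -> ball z R y -> `|x - z| + `|y - x| < R ->
  forall h, solvable ('d F z) C ('d F y h - 'd F x h)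
    ((df (`|y - x| + `|x - z|) - df `|x - z|) * `|h|).

Context (z : X) (R : K) (f df : K -> K).
Hypothesis ballR : ball z R `<=` Omega.
Hypothesis fd : has_derivative R f df.
Hypothesis cvx : convex_on R df.
Hypothesis inc : increasing_on R df.
Hypothesis df0 : df 0 = -1.
Hypothesis maj : majorizes z R df.

Lemma ball_differentiable x : `|x - z| < R -> differentiable F x.
Proof. by move=> xR; apply: C1F.1; apply: ballR; rewrite -ball_normE/= distrC. Qed.

Lemma ball_diff_continuous x : `|x - z| < R -> continuous ('d F x).
Proof. by move=> /ball_differentiable dx; exact: diff_continuous. Qed.

Lemma solvable_near x a w : `|x - z| <= a -> a < R -> df a < 0 ->
  solvable ('d F x) C ('d F z w) (`|w| / - df a).
Proof.
move=> xa aR dfa.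
have d0 := df0; have xR : `|x - z| < R := le_lt_trans xa aR.
have R0 : 0 < R := le_lt_trans (normr_ge0 _) xR.
have dfx : df `|x - z| <= df a by apply: (increasing_on_le inc).
have df0x : df 0 <= df `|x - z| by apply: (increasing_on_le inc).
have zz : `|z - z| < R by rewrite subrr normr0.
apply: (@solvable_le _ _ _ _ _ _ (`|w| / (1 - (1 + df `|x - z|)))).
  apply: ler_wpM2l => //.
  by rewrite lef_pV2 ?posrE; lra.
apply: (@solvable_perturb K X Y ('d F z)) => //.
- exact: ball_diff_continuous.
- exact: ball_diff_continuous.
- by apply/andP; split; lra.
move=> h; have := maj (x := z) (y := x) _ _ _ h.
rewrite subrr normr0 addr0 add0r df0 opprK [df _ + 1]addrC; apply=> //.
- exact: ballxx.
- by rewrite -ball_normE/= distrC.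
Qed.

(* The pair (linearization error, majorant error), as a curve in Y * K, has its
   derivative in the closed cone of solvable pairs. *)
Lemma linearization_error x y a b :
  `|x - z| <= a -> a < b -> b < R -> `|y - x| <= b - a ->
  solvable ('d F z) C (- (F y - F x - 'd F x (y - x)))
    ((f b - f a - df a * (b - a)) * (`|y - x| / (b - a)) ^+ 2).
Proof.
move=> xa ab bR yxb.
have a0 : 0 <= a := le_trans (normr_ge0 _) xa.
have ba0 : 0 < b - a by rewrite subr_gt0.
have [fe [dfe [H E]]] := fd.
pose h := y - x; pose k := (`|h| / (b - a)) ^+ 2.
have xR : `|x - z| < R by lra.
have dFx := ball_differentiable xR.
pose G (u : X) : Y := 'd F x u - F u.
pose p (u : K) : K := k * (fe u - df a * u).
have seg (t : K) : 0 <= t <= 1 -> `|x + t *: h - z| <= `|x - z| + t * `|h|.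
  move=> /andP[t0 t1]; rewrite addrAC (le_trans (ler_normD _ _))//.
  by rewrite normrZ ger0_norm.
have segR (t : K) : 0 <= t <= 1 -> `|x + t *: h - z| < R.
  move=> t01; apply: le_lt_trans (seg t t01) _.
  have /andP[t0 t1] := t01.
  have : t * `|h| <= 1 * `|h| by rewrite ler_wpM2r.
  by rewrite -/h in yxb; lra.
have dG u : differentiable F u -> 'd G u h = 'd F x h - 'd F u h /\ differentiable G u.
  move=> dFu; have cx := ball_diff_continuous xR.
  have dx : differentiable ('d F x) u by exact: linear_differentiable.
  by split; [rewrite [in LHS](diffB dx dFu)/= diff_lin|exact: differentiableB].
pose c (t : K) : Y * K^o := (G (x + t *: h), p (a + t * (b - a))).
pose dc (t : K) : Y * K^o :=
  ('d F x h - 'd F (x + t *: h) h, (b - a) * (k * (dfe (a + t * (b - a)) - df a))).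
have cd (t : K) : 0 <= t <= 1 -> is_derive t 1 c (dc t).
  move=> t01; have /andP[t0 t1] := t01; apply: is_derive_pair.
    have [<- dGt] := dG _ (ball_differentiable (segR t t01)).
    exact: is_derive_line.
  apply: is_derive_line_real.
  have tb : a + t * (b - a) < R.
    have : t * (b - a) <= 1 * (b - a) by rewrite ler_pM2r.
    by lra.
  have Ht := H _ tb.
  rewrite (_ : k * _ = k *: (dfe (a + t * (b - a)) - df a *: (1 : K))); last first.
    by rewrite -[df a *: 1]/(df a * 1) mulr1.
  have Di := is_deriveZ (df a) (is_derive_id (a + t * (b - a)) (1 : K)).
  exact: (is_deriveZ k (is_deriveB Ht Di)).
have Dd (t : K) : 0 < t < 1 -> solvable ('d F z) C (dc t).1 (dc t).2.
  move=> /andP[t0 t1]; have t01 : 0 <= t <= 1 by rewrite !ltW.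
  have th : `|x + t *: h - x| = t * `|h|.
    by rewrite addrAC subrr add0r normrZ gtr0_norm.
  have th1 : t * `|h| <= t * (b - a) by rewrite ler_pM2l.
  have tb : t * (b - a) < 1 * (b - a) by rewrite ltr_pM2r.
  have := maj (x := x) (y := x + t *: h) _ _ _ (- h).
  rewrite th !linearN normrN opprK [- _ + _]addrC /= => M.
  apply: solvable_le (M _ _ _); last 3 first.
  - by rewrite -ball_normE/= distrC.
  - by rewrite -ball_normE/= distrC; exact: segR.
  - by lra.
  have S := convex_on_slope (s := t * `|h|) (r := t * (b - a)) cvx (normr_ge0 _) xa.
  have {}S : (df (`|x - z| + t * `|h|) - df `|x - z|) * (b - a) <=
      (df (a + t * (b - a)) - df a) * `|h|.
    rewrite -(ler_pM2r t0) -mulrA [(b - a) * t]mulrC -[leRHS]mulrA [`|h| * t]mulrC.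
    by apply: S => //; [rewrite mulr_ge0// ltW|lra].
  have [|_ <-] := E (a + t * (b - a)).
    by apply/andP; split; [rewrite addr_ge0// mulr_ge0// ltW|lra].
  rewrite [t * _ + _]addrC /k.
  have -> : (b - a) * ((`|h| / (b - a)) ^+ 2 * (df (a + t * (b - a)) - df a)) =
      (df (a + t * (b - a)) - df a) * `|h| / (b - a) * `|h|.
    by field; rewrite gt_eqF.
  by rewrite ler_wpM2r// ler_pdivlMr.
have clD := solvable_closed rX (ball_diff_continuous (x := z) _) cC clC.
have := @cone_mean_value K _ [set q : Y * K^o | solvable ('d F z) C q.1 q.2] c dc
  (solvable_cone _ cC) (clD _) cd Dd.
rewrite subrr normr0 => /(_ (le_lt_trans (normr_ge0 _) xR)) /=.
rewrite scale1r scale0r addr0 mul1r mul0r addr0 /G /p.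
rewrite [x + h]addrC subrK [a + (b - a)]addrC subrK.
have [|<- _] := E a; first by lra.
have [|<- _] := E b; first by lra.
rewrite -!mulrBr [k * _]mulrC.
rewrite (_ : f b - df a * b - _ = f b - f a - df a * (b - a)); last by ring.
have Y4 (u v p' q : Y) : u - v + (p' - q) = u - q + (p' - v).
  by rewrite [p' - q]addrC addrACA [- v + _]addrC.
have -> : - (F y - F x - 'd F x (y - x)) = 'd F x y - F y - ('d F x x - F x).
  by rewrite [in LHS](linearB ('d F x)) !opprB Y4.
by [].
Qed.

Lemma solvable_comp (A0 A : {linear X -> Y}) y r m : 0 < m ->
  (forall w, solvable A C (A0 w) (`|w| / m)) -> solvable A0 C y r ->
  solvable A C y (r / m).
Proof.
move=> m0 H [w wr Cw]; have [d dw Cd] := H w; exists d.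
  by rewrite (le_trans dw)// ler_pM2r// invr_gt0.
by rewrite -(subrK (A0 w) (A d)) -addrA; have [_ + _] := cC; apply.
Qed.

Lemma newton_next x d a b : `|x - z| <= a -> a < b -> b < R -> df b < 0 ->
  C (F x + 'd F x d) -> `|d| <= b - a ->
  solvable ('d F (x + d)) C (- F (x + d))
    ((f b - f a - df a * (b - a)) * (`|d| / (b - a)) ^+ 2 / - df b).
Proof.
move=> xa ab bR dfb Cd dab.
have xdx : x + d - x = d by rewrite addrAC subrr add0r.
have yb : `|x + d - z| <= b.
  by rewrite addrAC (le_trans (ler_normD _ _))//; lra.
have := linearization_error (y := x + d) xa ab bR; rewrite xdx => /(_ dab) L.
have [||e er Ce] := solvable_comp (A := 'd F (x + d)) _ _ L (m := - df b).
- by rewrite oppr_gt0.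
- by move=> w; exact: (solvable_near w yb bR dfb).
exists e => //.
have := (let: And3 _ CD _ := cC in CD) _ _ Ce Cd; congr C.
by rewrite !opprK -addrA; congr (_ + _); rewrite [F x + 'd F x d]addrC addrA !subrK.
Qed.

Section Shift.
Context (xh : X) (rho : K) (dg : K -> K).
Hypothesis xhrho : `|xh - z| <= rho.
Hypothesis rhoR : rho < R.
Hypothesis dfrho : df rho < 0.
Hypothesis dgE : forall u, 0 <= u < R - rho -> dg u = df (u + rho) / - df rho.

Lemma majorizes_shift : majorizes xh (R - rho) dg.
Proof.
move=> x y; rewrite -!ball_normE/= ![`|xh - _|]distrC => xR yR xyR h.
have m0 : 0 < - df rho by rewrite oppr_gt0.
have xz : `|x - z| <= `|x - xh| + rho.
  by rewrite -(subrK xh x) -addrA (le_trans (ler_normD _ _))// addrK lerD2l.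
have yz : `|y - z| <= `|y - xh| + rho.
  by rewrite -(subrK xh y) -addrA (le_trans (ler_normD _ _))// addrK lerD2l.
have rr := rhoR; have L := maj (x := x) (y := y) _ _ _ h.
have n1 := normr_ge0 (x - xh); have n2 := normr_ge0 (y - x).
have {}L : solvable ('d F z) C ('d F y h - 'd F x h)
    ((df (`|y - x| + `|x - z|) - df `|x - z|) * `|h|).
  by apply: L; [rewrite -ball_normE/= distrC; lra|rewrite -ball_normE/= distrC; lra|lra].
have {L} := solvable_comp m0 (fun w => solvable_near w xhrho rhoR dfrho) L.
apply: solvable_le.
rewrite !dgE; [|lra|lra].
rewrite -mulrBl [leRHS]mulrAC ler_wpM2r ?invr_ge0 ?(ltW m0)// ler_wpM2r//.
rewrite -addrA [`|y - x| + _]addrC [X in _ <= df X - _]addrC.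
by apply: (convex_on_incr cvx) => //; lra.
Qed.

Lemma solvable_shift : 0 < rho -> solvable ('d F z) C (- F z) (f 0) ->
  solvable ('d F xh) C (- F xh) ((f rho + 2 * rho) / - df rho).
Proof.
move=> rho0 S0; have m0 : 0 < - df rho by rewrite oppr_gt0.
apply: (solvable_comp m0 (fun w => solvable_near w xhrho rhoR dfrho)).
have [||d1 d1r Cd1] := linearization_error (x := z) (y := xh) (a := 0) _ rho0 rhoR.
- by rewrite subrr normr0.
- by rewrite subr0.
move: d1r; rewrite subr0 => d1r.
have {}d1r : `|d1| <= f rho - f 0 + rho.
  apply: le_trans d1r _; rewrite df0.
  have T := tangent_lt fd inc (lexx 0) rho0 rhoR; rewrite df0 subr0 in T.
  rewrite mulN1r opprK -[leRHS]mulr1 ler_wpM2l//; first by lra.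
  by rewrite expr_le1// ?divr_ge0 ?(ltW rho0)// ler_pdivrMr// mul1r.
have [d0 d0r Cd0] := S0.
exists (d0 + d1 + (z - xh)).
  rewrite (le_trans (ler_normD _ _))// (distrC z).
  by have := ler_normD d0 d1; have := xhrho; lra.
have [_ CD _] := cC; have := CD _ _ Cd0 Cd1; congr C.
have E (u v w p q : Y) : u + q + (v + (p - q - w)) = u + v - w + p.
  by rewrite addrACA [q + _]addrC [p - q - w]addrAC subrK -[RHS]addrA [- w + p]addrC.
rewrite !opprK E; congr (_ + _).
by rewrite -(opprB xh z); move: (xh - z) => w; rewrite !linearD linearN.
Qed.

End Shift.
End Majorant.

Lemma newton_dirs_min x r : differentiable F x -> solvable ('d F x) C (- F x) r ->
  newton_dirs F C x !=set0.
Proof.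
move=> dF [d0 _ Cd0].
pose A := [set `|d| | d in feasible F C x].
have hA : has_inf A.
  split; first by exists `|d0|, d0 => //; rewrite /feasible/= addrC -[F x]opprK.
  by exists 0 => _ [d _ <-].
have /choice[d dP] n : exists d, `|d| <= inf A + n.+1%:R^-1 /\ feasible F C x d.
  have [|_ [d Cd <-] dn] := @inf_adherent _ A n.+1%:R^-1 _ hA.
    by rewrite invr_gt0.
  by exists d; split=> //; exact: ltW.
have [||||m mr Cm] := @reflexive_cone_limit K X Y ('d F x) C d
  (fun n => inf A + n.+1%:R^-1) (inf A) (fun=> F x) (F x) rX (diff_continuous dF) cC clC.
- by move=> n; have [] := dP n.
- exact: cvg_add_harmonic.
- exact: cvg_cst.
- by move=> n; rewrite addrC; have [] := dP n.
exists m; split; first by rewrite /feasible/= addrC.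
move=> d' Cd'; apply: le_trans mr _; apply: ge_inf; first exact: hA.2.
by exists d'.
Qed.

Lemma newton_dirs_le x r d : solvable ('d F x) C (- F x) r ->
  newton_dirs F C x d -> `|d| <= r.
Proof.
move=> [e er Ce] [_ dmin]; apply: le_trans (dmin e _) er.
by rewrite /feasible/= addrC -[F x]opprK.
Qed.

End Inclusion.

(** * Convergence of majorized sequences *)

Section Convergence.
Context {K : realType}.

Lemma majorized_seq_dist (X : normedModType K) (x : nat -> X) (t : nat -> K) k n :
  (forall k, `|x k.+1 - x k| <= t k.+1 - t k) -> `|x (k + n)%N - x k| <= t (k + n)%N - t k.
Proof.
move=> xt; elim: n => [|n IH]; first by rewrite addn0 !subrr normr0.
rewrite addnS -(subrK (x (k + n)%N) (x _.+1)) -addrA.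
by rewrite (le_trans (ler_normD _ _))//; have := xt (k + n)%N; lra.
Qed.

Lemma cvg_dist_le (X : normedModType K) (x : nat -> X) (xs y : X) (r : K) k :
  x @ \oo --> xs -> (forall n, `|x (k + n)%N - y| <= r) -> `|xs - y| <= r.
Proof.
move=> xxs xr.
have c : (fun n => `|x n - y|) @ \oo --> `|xs - y|.
  by apply: cvg_norm; apply: cvgB => //; exact: cvg_cst.
apply: (ler_cvg_to c (cvg_cst r)); near=> n.
have kn : (k <= n)%N by near: n; exact: nbhs_infty_ge.
by rewrite -(subnKC kn); exact: xr.
Unshelve. all: by end_near. Qed.

Lemma majorized_seq_cvg (X : completeNormedModType K) (x : nat -> X) (t : nat -> K) ts :
  (forall k, t k <= ts) -> t @ \oo --> ts -> (forall k, `|x k.+1 - x k| <= t k.+1 - t k) ->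
  exists2 xs, x @ \oo --> xs & forall k, `|xs - x k| <= ts - t k.
Proof.
move=> tts tcv xt.
have D k n : `|x (k + n)%N - x k| <= ts - t k.
  by have := majorized_seq_dist k n xt; have := tts (k + n)%N; lra.
have cx : cvg (x @ \oo).
  apply: cauchy_cvg; apply: cauchy_exP => e e0.
  have /cvgrPdist_lt/(_ e e0)[N _ NP] := tcv.
  exists (x N); exists N => // n /= Nn.
  rewrite -ball_normE/= distrC -(subnKC Nn); apply: le_lt_trans (D _ _) _.
  by have := NP N (leqnn N); rewrite /= ger0_norm// subr_ge0.
exists (lim (x @ \oo)) => // k.
exact: cvg_dist_le cx (D k).
Qed.

Lemma limn_esup_le (u : nat -> K) l :
  (forall e, 0 < e -> \forall n \near \oo, u n <= l + e) ->
  (limn_esup (fun n => (u n)%:E) <= l%:E)%E.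
Proof.
move=> H; apply/lee_addgt0Pr => e e0; rewrite -EFinD.
apply: (@le_trans _ _ (ereal_sup ((fun n => (u n)%:E) @` [set n | u n <= l + e]))).
  by apply: ereal_inf_lbound; exists [set n | u n <= l + e] => //; exact: H.
by apply: ge_ereal_sup => _ [n /= un <-]; rewrite lee_fin.
Qed.

(* With b_k = |xs - x_k|, a_k = |x_(k+1) - x_k| and d = Th s_k, the steps after k
   contract by d, so b_m (1 - d) <= a_m for m >= k; hence
   b_(k+1) / b_k^2 <= Th (1 - d) / (1 - 2 d)^2. *)
Lemma quadratic_limsup (X : normedModType K) (x : nat -> X) (xs : X) (s : nat -> K) (Th : K) :
  0 <= Th -> x @ \oo --> xs -> s @ \oo --> 0 ->
  (forall k, s k.+1 <= s k) -> (forall k, `|x k.+1 - x k| <= s k) ->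
  (forall k, `|x k.+2 - x k.+1| <= Th * `|x k.+1 - x k| ^+ 2) ->
  (limn_esup (fun k => (`|xs - x k.+1| / `|xs - x k| ^+ 2)%:E) <= Th%:E)%E.
Proof.
move=> Th0 xxs s0 sdec xs_ quad.
pose a k := `|x k.+1 - x k|.
have smono k n : s (k + n)%N <= s k.
  by elim: n => [|n IH]; rewrite ?addn0// addnS (le_trans (sdec _)).
have tail k m : (k <= m)%N -> `|xs - x m| * (1 - Th * s k) <= a m.
  move=> km; have [d1|d1] := leP (1 - Th * s k) 0.
    by apply: (@le_trans _ _ 0); [exact: mulr_ge0_le0|exact: normr_ge0].
  rewrite -ler_pdivlMr//.
  apply: (@cvg_dist_le X x xs (x m) _ m xxs) => n.
  rewrite ler_pdivlMr//.
  have: `|x (m + n)%N - x m| * (1 - Th * s k) + a (m + n)%N <= a m.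
    elim: n => [|n IH]; first by rewrite addn0 subrr normr0 mul0r add0r.
    have smn : s (m + n)%N <= s k by rewrite -(subnKC km) -addnA.
    have q : a (m + n).+1 <= Th * s k * a (m + n)%N.
      apply: le_trans (quad _) _; rewrite expr2 mulrA ler_wpM2r//.
      by rewrite ler_wpM2l// (le_trans (xs_ _)).
    have tri : `|x (m + n).+1 - x m| <= a (m + n)%N + `|x (m + n)%N - x m|.
      by rewrite -(subrK (x (m + n)%N) (x _.+1)) -addrA (le_trans (ler_normD _ _)).
    rewrite addnS; have := ler_wpM2r (ltW d1) tri; lra.
  by apply: le_trans; rewrite lerDl normr_ge0.
have Ths : (fun k => Th * s k) @ \oo --> 0.
  by rewrite -[X in _ --> X](mulr0 Th); apply: cvgMr.
pose v k : K := Th * (1 - Th * s k) / (1 - 2 * (Th * s k)) ^+ 2.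
have vTh : v @ \oo --> Th.
  have c1 : (fun k => 1 - Th * s k) @ \oo --> (1 : K).
    by rewrite -[X in _ --> X]subr0; apply: cvgB => //; exact: cvg_cst.
  have c2 : (fun k => 1 - 2 * (Th * s k)) @ \oo --> (1 : K).
    rewrite -[X in _ --> X]subr0; apply: cvgB; first exact: cvg_cst.
    by rewrite -[X in _ --> X](mulr0 2); apply: cvgMr.
  suff : v @ \oo --> Th * 1 / 1 ^+ 2 by rewrite expr1n divr1 mulr1.
  apply: cvgM; first exact: cvgMr.
  apply: cvgV; first by rewrite expr1n oner_neq0.
  by rewrite !expr2; apply: cvgM.
apply: limn_esup_le => e e0.
have vn : \forall k \near \oo, v k <= Th + e.
  by move/cvgr_le : vTh; apply; rewrite ltrDl.
near=> k.
have d2 : Th * s k < 1 / 2.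
  by near: k; apply: (cvgr_lt _ Ths); lra.
have vk : v k <= Th + e by near: k.
apply: le_trans vk; rewrite /v.
have n0 := normr_ge0 (xs - x k); have n1 := normr_ge0 (xs - x k.+1).
have [b0|b0] := eqVneq `|xs - x k| 0.
  rewrite b0 expr0n invr0 mulr0 divr_ge0 ?exprn_ge0 ?mulr_ge0//; lra.
have b1 : 0 < `|xs - x k| by rewrite lt_neqAle eq_sym b0.
have T1 := tail k k.+1 (leqnSn k).
have sk : 0 <= s k by rewrite (le_trans _ (xs_ k)).
have ak : 0 <= a k := normr_ge0 _.
have q : a k.+1 <= Th * a k ^+ 2 := quad k.
have q' : a k.+1 <= Th * s k * a k.
  by apply: le_trans q _; rewrite expr2 mulrA ler_wpM2r// ler_wpM2l// xs_.
have tri : a k <= `|xs - x k| + `|xs - x k.+1|.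
  rewrite /a -{1}(subrK xs (x k.+1)) -addrA (le_trans (ler_normD _ _))//.
  by rewrite (distrC (x k.+1)) [leRHS]addrC.
move: (Th * s k) d2 q' T1 (mulr_ge0 Th0 sk) => d d2 q' T1 d0.
rewrite ler_pdivrMr ?exprn_gt0// mulrAC ler_pdivlMr; last by rewrite exprn_gt0; lra.
have T3 : a k * (1 - 2 * d) <= `|xs - x k| * (1 - d) by nra.
have T4 : `|xs - x k.+1| * (1 - d) <= Th * a k ^+ 2 by lra.
have T5 : (a k * (1 - 2 * d)) ^+ 2 <= (`|xs - x k| * (1 - d)) ^+ 2.
  by rewrite ler_sqr ?nnegrE//; apply: mulr_ge0 => //; lra.
rewrite -(ler_pM2r (_ : 0 < 1 - d)); last by lra.
have T6 : `|xs - x k.+1| * (1 - d) * (1 - 2 * d) ^+ 2 <= Th * a k ^+ 2 * (1 - 2 * d) ^+ 2.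
  by rewrite ler_wpM2r// sqr_ge0.
have T7 : Th * (a k * (1 - 2 * d)) ^+ 2 <= Th * (`|xs - x k| * (1 - d)) ^+ 2.
  by rewrite ler_wpM2l.
by lra.
Unshelve. all: by end_near. Qed.

End Convergence.

(** * Newton's method for the inclusion *)

Section NewtonInclusion.
Context {K : realType} {X Y : completeNormedModType K}.
Context (Omega : set X) (F : X -> Y) (C : set Y).
Hypothesis rX : reflexive_space X.
Hypothesis C1F : C1_frechet Omega F.
Hypothesis coneC : closed_convex_cone C.
Context (z : X) (R : K) (f df : K -> K).
Hypothesis ballR : ball z R `<=` Omega.
Hypothesis fd : has_derivative R f df.
Hypothesis cvx : convex_on R df.
Hypothesis inc : increasing_on R df.
Hypothesis df0 : df 0 = -1.
Hypothesis maj : majorizes F C z R df.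
Context (ts : K) (t : nat -> K).
Hypothesis tsR : ts < R.
Hypothesis t0 : t 0%N = 0.
Hypothesis tin : forall k, 0 <= t k < ts.
Hypothesis tlt : forall k, t k < t k.+1.
Hypothesis tdf : forall k, df (t k) < 0.
Hypothesis terr : forall k, (t k.+2 - t k.+1) * - df (t k.+1) =
  f (t k.+1) - f (t k) - df (t k) * (t k.+1 - t k).
Hypothesis Fz : solvable ('d F z) C (- F z) (t 1%N - t 0%N).

Let admissible k x :=
  `|x - z| <= t k /\ solvable ('d F x) C (- F x) (t k.+1 - t k).

Lemma newton_advance k x x' : admissible k x -> newton_step F C x x' ->
  [/\ `|x' - x| <= t k.+1 - t k, admissible k.+1 x' &
    forall x'', newton_step F C x' x'' ->
      `|x'' - x'| <= (t k.+2 - t k.+1) / (t k.+1 - t k) ^+ 2 * `|x' - x| ^+ 2].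
Proof.
move=> [xz Sx] [d dd <-].
have dt := newton_dirs_le Sx dd; have [Cd _] := dd.
have xdx : x + d - x = d by rewrite addrAC subrr add0r.
have /andP[_ tR] := tin k.+1.
have N := newton_next rX C1F coneC ballR fd cvx inc df0 maj xz (tlt k)
  (lt_trans tR tsR) (tdf _) Cd dt.
have tk := tlt k; have tk1 := tlt k.+1.
have p0 : 0 < - df (t k.+1) by rewrite oppr_gt0.
have {}N : solvable ('d F (x + d)) C (- F (x + d))
    ((t k.+2 - t k.+1) / (t k.+1 - t k) ^+ 2 * `|d| ^+ 2).
  apply: solvable_le N; rewrite -terr le_eqVlt; apply/orP; left; apply/eqP.
  by field; rewrite subr_eq0 (lt_eqF (tdf k.+1)) (gt_eqF tk).
rewrite xdx; split=> //.
- split; first by rewrite addrAC (le_trans (ler_normD _ _))//; lra.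
  apply: solvable_le N.
  rewrite mulrAC -mulrA -[leRHS]mulr1 ler_wpM2l ?subr_ge0 ?(ltW tk1)//.
  rewrite ler_pdivrMr ?exprn_gt0 ?subr_gt0// mul1r ler_sqr ?nnegrE//.
  by rewrite subr_ge0 ltW.
- move=> _ [d' dd' <-]; rewrite addrAC subrr add0r.
  exact: newton_dirs_le N dd'.
Qed.

Lemma newton_admissible (x : nat -> X) n : x 0%N = z ->
  (forall k, (k < n)%N -> newton_step F C (x k) (x k.+1)) -> admissible n (x n).
Proof.
move=> x0; elim: n => [_|n IH H].
  by split; rewrite x0 ?subrr ?normr0 ?t0// -t0.
have An : admissible n (x n) by apply: IH => k kn; apply: H; exact: ltnW.
by have [] := newton_advance An (H n (ltnSn n)).
Qed.

Lemma newton_well_defined (x : nat -> X) n : x 0%N = z ->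
  (forall k, (k < n)%N -> newton_step F C (x k) (x k.+1)) ->
  Omega (x n) /\ newton_dirs F C (x n) !=set0.
Proof.
move=> x0 /(newton_admissible x0)[xz S].
have xR : `|x n - z| < R.
  by apply: le_lt_trans xz _; have /andP[_ tn] := tin n; exact: lt_trans tsR.
split; first by apply: ballR; rewrite -ball_normE/= distrC.
exact: newton_dirs_min (ball_differentiable C1F ballR xR) S.
Qed.

Context (Th : K).
Hypothesis tcv : t @ \oo --> ts.
Hypothesis ratio : forall k, (t k.+2 - t k.+1) / (t k.+1 - t k) ^+ 2 <= Th.

Lemma newton_converges (x : nat -> X) : x 0%N = z ->
  (forall k, newton_step F C (x k) (x k.+1)) ->
  [/\ forall k, ball z ts (x k),
      forall k, `|x k.+1 - x k| <= t k.+1 - t k,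
      forall k, `|x k.+2 - x k.+1| <=
          (t k.+2 - t k.+1) / (t k.+1 - t k) ^+ 2 * `|x k.+1 - x k| ^+ 2 /\
        (t k.+2 - t k.+1) / (t k.+1 - t k) ^+ 2 * `|x k.+1 - x k| ^+ 2 <=
          Th * `|x k.+1 - x k| ^+ 2 &
      exists xs : X,
        [/\ x @ \oo --> xs, closed_ball z ts xs, Omega xs /\ C (F xs),
            forall k, `|xs - x k| <= ts - t k &
            (limn_esup (fun k =>
              (`|xs - x k.+1| / `|xs - x k| ^+ 2)%:E) <= Th%:E)%E] ].
Proof.
move=> x0 xS.
have adm k : admissible k (x k) by apply: newton_admissible => // j _.
have xt k : `|x k.+1 - x k| <= t k.+1 - t k by have [] := newton_advance (adm k) (xS k).
have quad k : `|x k.+2 - x k.+1| <=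
    (t k.+2 - t k.+1) / (t k.+1 - t k) ^+ 2 * `|x k.+1 - x k| ^+ 2.
  by have [_ _] := newton_advance (adm k) (xS k); apply.
have quadTh k : (t k.+2 - t k.+1) / (t k.+1 - t k) ^+ 2 * `|x k.+1 - x k| ^+ 2 <=
    Th * `|x k.+1 - x k| ^+ 2 by rewrite ler_wpM2r// sqr_ge0.
split=> //.
  move=> k; rewrite -ball_normE/= distrC.
  by apply: le_lt_trans (adm k).1 _; have /andP[] := tin k.
have ts0 : 0 < ts by have /andP[] := tin 0; rewrite t0.
have tts k : t k <= ts by have /andP[_ /ltW] := tin k.
have [xs xxs xst] := majorized_seq_cvg tts tcv xt.
have xsz : `|xs - z| <= ts by have := xst 0%N; rewrite x0 t0 subr0.
have xsR : `|xs - z| < R := le_lt_trans xsz tsR.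
have Oxs : Omega xs by apply: ballR; rewrite -ball_normE/= distrC.
have dFxs := ball_differentiable C1F ballR xsR.
exists xs; split=> //.
- by rewrite closed_ballE// /closed_ball_/= distrC.
- split=> //.
  pose d k := x k.+1 - x k.
  have d0 : d @ \oo --> 0.
    by rewrite -(subrr xs); apply: cvgB => //; rewrite cvg_shiftS.
  have dF0 : (fun k => 'd F (x k) (d k)) @ \oo --> 0.
    apply/norm_cvg0P; apply: (@squeeze_cvgr _ _ _ _ (fun=> 0) (fun k => `|'d F xs (d k)| + `|d k|)).
    + have near1 := xxs _ (C1F.2 xs Oxs 1 ltr01).
      near=> k; rewrite normr_ge0/=.
      have : forall d, `|'d F (x k) d - 'd F xs d| <= 1 * `|d| by near: k; exact: near1.
      move=> /(_ (d k)); rewrite mul1r => h.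
      rewrite -(subrK ('d F xs (d k)) ('d F (x k) (d k))) (le_trans (ler_normD _ _))//.
      by rewrite addrC lerD2l.
    + exact: cvg_cst.
    + rewrite -[X in _ --> X](addr0 0); apply: cvgD; last by apply/norm_cvg0P.
      apply/norm_cvg0P; rewrite -(linear0 ('d F xs)).
      apply: continuous_cvg d0; exact: diff_continuous.
  have cF : (fun k => F (x k) + 'd F (x k) (d k)) @ \oo --> F xs.
    rewrite -[X in _ --> X]addr0; apply: cvgD => //.
    by apply: continuous_cvg xxs; exact: differentiable_continuous.
  apply: (@closed_cvg _ _ \oo _ (fun k => F (x k) + 'd F (x k) (d k)) C) => //.
    exact: (closed_convex_coneP coneC).2.
  apply: nearW => k; have [e [Ce _] xe] := xS k.
  by rewrite /d -xe addrAC subrr add0r.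
- apply: (@quadratic_limsup _ _ _ _ (fun k => ts - t k)) => //.
  + apply: le_trans (ratio 0).
    by rewrite divr_ge0 ?sqr_ge0// subr_ge0 ltW.
  + by rewrite -(subrr ts); apply: cvgB => //; exact: cvg_cst.
  + by move=> k; have := tlt k; lra.
  + by move=> k; apply: le_trans (xt k) _; have := tts k.+1; lra.
  + by move=> k; exact: le_trans (quadTh k).
Unshelve. all: by end_near. Qed.

End NewtonInclusion.

Section ShiftedMajorant.
Context {K : realType}.
Implicit Types (f df : K -> K) (R rho : K).

Lemma has_derivative_shift R f df rho c m : 0 <= rho -> has_derivative R f df ->
  has_derivative (R - rho) (fun u => c * (f (u + rho) + m)) (fun u => c * df (u + rho)).
Proof.
move=> rho0 [fe [dfe [H E]]].
exists (fun u => c * (fe (u + rho) + m)), (fun u => c * dfe (u + rho)).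
split=> u; last by move=> uR; have [|-> ->] := E (u + rho); first by lra.
move=> uR; have Hu := H (u + rho) ltac:(lra).
have Hs : is_derive u (1 : K) (fun s => fe (rho + s * 1)) (1 * dfe (u + rho)).
  by apply: is_derive_line_real; rewrite mulr1 addrC.
have -> : (fun s => c * (fe (s + rho) + m)) = c \*: ((fun s => fe (rho + s * 1)) + cst m).
  by apply/funext => s; rewrite [s + rho]addrC -[s in LHS]mulr1.
have -> : c * dfe (u + rho) = c *: (1 * dfe (u + rho) + 0) by rewrite addr0 mul1r.
have Hc := is_derive_cst m u (1 : K).
exact: (is_deriveZ c (is_deriveD Hs Hc)).
Qed.

Lemma has_derivative_eq R f df df' : (forall u, 0 <= u < R -> df' u = df u) ->
  has_derivative R f df -> has_derivative R f df'.
Proof.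
move=> E' [fe [dfe [H E]]]; exists fe, dfe; split=> // u uR.
by rewrite E'//; exact: E.
Qed.

Lemma convex_on_shift R df dg rho c : 0 <= rho -> 0 <= c ->
  (forall u, 0 <= u < R - rho -> dg u = c * df (u + rho)) ->
  convex_on R df -> convex_on (R - rho) dg.
Proof.
move=> rho0 c0 E cv u v w u0 uv vw wR.
rewrite !E; [|lra..].
have := cv (u + rho) (v + rho) (w + rho) ltac:(lra) ltac:(lra) ltac:(lra) ltac:(lra).
by move=> /(ler_wpM2l c0); lra.
Qed.

Lemma increasing_on_shift R df dg rho c : 0 <= rho -> 0 < c ->
  (forall u, 0 <= u < R - rho -> dg u = c * df (u + rho)) ->
  increasing_on R df -> increasing_on (R - rho) dg.
Proof.
move=> rho0 c0 E inc u v u0 uv vR.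
rewrite !E; [|lra..].
by rewrite ltr_pM2l//; apply: inc; lra.
Qed.

Lemma shift_bound R f df rho : 0 < R -> has_derivative R f df -> increasing_on R df ->
  0 < f 0 -> df 0 = -1 -> 0 <= rho ->
  rho < sup [set - f t | t in `[0, R[] / 2 ->
  exists2 u, rho < u < R & f u + 2 * rho < 0 /\ df rho < 0.
Proof.
move=> R0 fd inc f0 df0 rho0 rhob.
have [||_ [u + <-] fu] := @sup_gt K [set - f t | t in `[0, R[] (2 * rho).
- by exists (- f 0), 0 => //=; rewrite in_itv/= lexx.
- by lra.
rewrite /= in_itv/= => /andP[u0 uR].
have Tu := tangent_le fd inc (lexx 0) u0 uR.
rewrite df0 in Tu.
have ru : rho < u by lra.
exists u; first by rewrite ru.
split; first by lra.
rewrite ltNge; apply/negP => dr.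
have Tr := tangent_lt fd inc rho0 ru uR.
have T0 := tangent_le fd inc (lexx 0) rho0 (lt_trans ru uR).
rewrite df0 in T0.
have : 0 <= df rho * (u - rho) by rewrite mulr_ge0//; lra.
by lra.
Qed.

End ShiftedMajorant.

Theorem theorem8 (K : realType) (X Y : completeNormedModType K)
    (Omega : set X) (F : X -> Y) (C : set Y) (R : K) (f : K -> K)
    (xt : X) (rho : K) :
  reflexive_space X ->
  open Omega ->
  C1_frechet Omega F ->
  closed_convex_cone C ->
  0 < R ->
  Omega xt ->
  robinson F C xt ->
  majorant Omega F C xt R f ->
  (exists2 t, t \in `]0, R[ & f t < 0) ->
  (set_norm (Tinv F C xt (- F xt)%R) <= (f 0)%:E)%E ->
  let beta := sup [set - f t | t in `[0, R[] in
  0 <= rho -> rho < beta / 2 ->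
  let df := derive_on `[0, R[ f in
  let g := fun t => - 1 / df rho * (f (t + rho) + 2 * rho) in
  let dg := derive_on `[0, R - rho[ g in
  let t := newton_iter `[0, R - rho[ g in
  exists ts : K,
  let Theta := left_derive dg ts / (- 2 * dg ts) in
  [/\ (ts \in `]0, R - rho[) /\ smallest_zero `[0, R - rho[ g ts,
      (forall k, [/\ t k \in `[0, R - rho[,
                    derivable_on `[0, R - rho[ g (t k) & dg (t k) != 0]),
      [/\ forall k, t k < t k.+1,
          forall k, t k \in `[0, ts[ &
          t @ \oo --> ts],
      (forall k, ts - t k.+1 <= (ts - t k) / 2) /\
      (forall k, ts - t k.+1 <= Theta * (ts - t k) ^+ 2) &
      forall xh, ball xt rho xh ->
      (* the vector sequence is well defined: no partial run can get stuck *)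
      (forall (n : nat) (x : nat -> X), x 0%N = xh ->
         (forall k, (k < n)%N -> newton_step F C (x k) (x k.+1)) ->
         Omega (x n) /\ newton_dirs F C (x n) !=set0) /\
      (forall x : nat -> X, x 0%N = xh ->
         (forall k, newton_step F C (x k) (x k.+1)) ->
         (* balls centred at the starting point: see FIDELITY in NOTES.md *)
         [/\ forall k, ball xh ts (x k),
             forall k, `|x k.+1 - x k| <= t k.+1 - t k,
             forall k,
               `|x k.+2 - x k.+1| <=
                 (t k.+2 - t k.+1) / (t k.+1 - t k) ^+ 2 *
                 `|x k.+1 - x k| ^+ 2 /\
               (t k.+2 - t k.+1) / (t k.+1 - t k) ^+ 2 *
                 `|x k.+1 - x k| ^+ 2 <=
                 Theta * `|x k.+1 - x k| ^+ 2 &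
             exists xs : X,
               [/\ x @ \oo --> xs,
                   closed_ball xh ts xs,
                   Omega xs /\ C (F xs),
                   forall k, `|xs - x k| <= ts - t k &
                   (* the ratio is 0 when x k = xs *)
                   (limn_esup (fun k =>
                      (`|xs - x k.+1| / `|xs - x k| ^+ 2)%:E) <= Theta%:E)%E] ])].
Proof.
move=> rX _ C1F coneC R0 Oxt rob [[fC1 _] ballR majF [[f0 df0] dfcv dfinc _]] _ Fxt
  beta rho0 rhob df g dg t.
have {}df0 : df 0 = -1 := df0.
have fd : has_derivative R f df := derivable_on_has_derivative R0 fC1.
have cvx : convex_on R df := convex_function_on dfcv.
have inc : increasing_on R df.
  by move=> a b a0 ab bR; apply: dfinc => //; rewrite in_itv/=; lra.
have [u0 /andP[ru uR] [fu dfr]] := shift_bound R0 fd inc f0 df0 rho0 rhob.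
have rR : rho < R := lt_trans ru uR.
have m0 : 0 < - df rho by rewrite oppr_gt0.
pose c := - 1 / df rho.
have cE : c = (- df rho)^-1 by rewrite /c mulN1r invrN.
have c0 : 0 < c by rewrite cE invr_gt0.
have gd0 : has_derivative (R - rho) g (fun u => c * df (u + rho)) :=
  has_derivative_shift c (2 * rho) rho0 fd.
have dgE u : 0 <= u < R - rho -> dg u = c * df (u + rho).
  by move=> uI; have [_] := has_derivative_derive_on gd0 uI.
have gd : has_derivative (R - rho) g dg := has_derivative_eq dgE gd0.
have cvxg := convex_on_shift rho0 (ltW c0) dgE cvx.
have incg := increasing_on_shift rho0 c0 dgE inc.
have dg0 : dg 0 = -1.
  by rewrite dgE ?add0r ?cE ?lexx/= ?subr_gt0// invrN mulNr mulVf// lt_eqF.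
have g0 : 0 < g 0.
  rewrite /g -/c add0r mulr_gt0//.
  by have := tangent_le fd inc (lexx 0) rho0 rR; rewrite df0; lra.
have gu : g (u0 - rho) < 0 by rewrite /g -/c subrK pmulr_rlt0.
have uI : 0 < u0 - rho < R - rho by lra.
have [ts [tsI gts dgts] gpos] := smallest_zero_exists gd incg g0 uI gu.
have /andP[ts0 tsR] := tsI.
have slope := left_derive_slope cvxg incg ts0 tsR.
have t0 : t 0%N = 0 by [].
have tS k : t k.+1 = t k - g (t k) / dg (t k) by [].
have tin := newton_in gd cvxg incg tsI gts dgts gpos slope t0 tS.
have tlt := newton_lt gd cvxg incg tsI gts dgts gpos slope t0 tS.
have tdf := newton_df gd cvxg incg tsI gts dgts gpos slope t0 tS.
have tcv := newton_cvg gd cvxg incg tsI gts dgts gpos slope t0 tS.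
have terr := newton_error gd cvxg incg tsI gts dgts gpos slope t0 tS.
have tratio := newton_ratio gd cvxg incg tsI gts dgts gpos slope t0 tS.
have tR k : 0 <= t k < R - rho by have := tin k; lra.
exists ts => Theta; split.
- rewrite in_itv/=; split=> //; split=> //; first by rewrite /= in_itv/=; lra.
  move=> s; rewrite /= in_itv/= => /andP[s0 sR] gs; rewrite leNgt; apply/negP => sts.
  by have := gpos s; rewrite s0 sts gs ltxx => /(_ isT).
- move=> k; split; first by rewrite in_itv/=.
    by have [] := has_derivative_derive_on gd (tR k).
  exact: ltr0_neq0.
- by split=> // k; rewrite in_itv/=.
- split=> k; first exact: (newton_half gd cvxg incg tsI gts dgts gpos slope t0 tS).
  exact: (newton_quadratic gd cvxg incg tsI gts dgts gpos slope t0 tS).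
move=> xh xhb; have xhr : `|xh - xt| < rho by move: xhb; rewrite -ball_normE/= distrC.
have xhr' := ltW xhr; have rho_gt0 : 0 < rho := le_lt_trans (normr_ge0 _) xhr.
have dFxt : differentiable F xt := C1F.1 _ Oxt.
have maj : majorizes F C xt R df.
  move=> x y xR yR xyR h.
  apply: (@svnorm_solvable K X Y F C rX coneC xt (fun d => 'd F y d - 'd F x d)) => //.
    by move=> a u v; rewrite (linearP ('d F y)) (linearP ('d F x)) [in RHS]scalerBr opprD addrACA.
  exact: majF.
have Sxt := set_norm_solvable rX coneC dFxt Fxt.
have ballh : ball xh (R - rho) `<=` Omega.
  move=> x; rewrite -ball_normE/= => xR; apply: ballR; rewrite -ball_normE/=.
  rewrite -(subrK xh xt) -addrA (le_lt_trans (ler_normD _ _))// distrC; lra.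
have majh : majorizes F C xh (R - rho) dg.
  apply: (majorizes_shift rX C1F coneC ballR cvx inc df0 maj xhr' rR dfr).
  by move=> u uR'; rewrite dgE// cE mulrC.
have Sxh : solvable ('d F xh) C (- F xh) (t 1%N - t 0%N).
  have -> : t 1%N - t 0%N = (f rho + 2 * rho) / - df rho.
    by rewrite tS t0 dg0 invrN1 mulrN1 opprK add0r subr0 /g -/c add0r cE mulrC.
  exact: (solvable_shift rX C1F coneC ballR fd cvx inc df0 maj xhr' rR dfr rho_gt0 Sxt).
split=> [n x x0 xS|x x0 xS].
  exact: (newton_well_defined rX C1F coneC ballh gd cvxg incg dg0 majh tsR t0 tin
    tlt tdf terr Sxh x0 xS).
exact: (newton_converges rX C1F coneC ballh gd cvxg incg dg0 majh tsR t0 tin tlt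
  tdf terr Sxh tcv tratio x0 xS).
Qed.
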